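(* For Lebesgue-almost every triangle $\Delta$ (in the space of triangles up to similarity, parametrized by two of its angles $(\alpha,\beta)$ ranging over $\{\alpha>0,\beta>0,\alpha+\beta<\pi\}$ with Lebesgue measure) the following holds. Let $v$ be a vertex of $\Delta$, let $\mu>\sqrt{3}-1$, and let $n_1<n_2<\cdots$ be the increasing enumeration of the (infinite) set of positive integers $n$ with $P_n(v)<e^{n^{\mu}}$. Then for every $\epsilon>0$ and all $i$ large enough, $$n_{i+1}-n_i<n_i^{1+\epsilon}.$$
   Context: Consider the billiard in a triangle $\Delta$. A generalized diagonal is a billiard orbit segment that starts at a vertex of $\Delta$ and ends at a vertex of $\Delta$; its length is its number of reflections. For a vertex $v$ of $\Delta$, $P_n(v)$ denotes the number of generalized diagonals of length at most $n$ emanating from $v$. *)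

(* Defs.v *)
From HB Require Import structures.
From mathcomp Require Import all_boot all_order all_algebra.
From mathcomp Require Import all_classical all_reals all_analysis.
Set Implicit Arguments. Unset Strict Implicit. Unset Printing Implicit Defensive.
Import Order.TTheory GRing.Theory Num.Theory.
Local Open Scope classical_set_scope.
Local Open Scope ring_scope.

Section Billiard.
Variable R : realType.
Notation pt := (R * R)%type.

Definition vsub (p q : pt) : pt := (p.1 - q.1, p.2 - q.2).
Definition dot (u w : pt) : R := u.1 * w.1 + u.2 * w.2.
Definition cross (u w : pt) : R := u.1 * w.2 - u.2 * w.1.
Definition vscale (t : R) (u : pt) : pt := (t * u.1, t * u.2).
Definition vadd (p u : pt) : pt := (p.1 + u.1, p.2 + u.2).

(* The triangle with angle a at A = (0,0), angle b at B = (1,0), and third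
   vertex C in the upper half-plane (counterclockwise orientation). *)
Definition vtx (a b : R) (i : 'I_3) : pt :=
  if val i == 0%N then (0, 0)
  else if val i == 1%N then (1, 0)
  else let t := sin b / sin (a + b) in (t * cos a, t * sin a).

Definition nextv (i : 'I_3) : 'I_3 := ordS i.

Definition tri_interior (a b : R) (p : pt) : Prop :=
  forall i : 'I_3,
    0 < cross (vsub (vtx a b (nextv i)) (vtx a b i)) (vsub p (vtx a b i)).

Definition on_open_side (a b : R) (i : 'I_3) (p : pt) : Prop :=
  exists s : R, 0 < s < 1 /\
    p = vadd (vtx a b i) (vscale s (vsub (vtx a b (nextv i)) (vtx a b i))).

Definition seg_inside (a b : R) (p q : pt) : Prop :=
  forall s : R, 0 < s < 1 -> tri_interior a b (vadd p (vscale s (vsub q p))).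

(* reflection of the vector d across a line with direction u (u <> 0) *)
Definition reflect (u d : pt) : pt :=
  vsub (vscale (2 * dot d u / dot u u) u) d.

Definition reflection_law (a b : R) (i : 'I_3) (o p q : pt) : Prop :=
  exists t : R, 0 < t /\
    vsub q p = vscale t (reflect (vsub (vtx a b (nextv i)) (vtx a b i)) (vsub p o)).

(* A generalized diagonal from vertex v, given as the list of its break points
   [:: q_0; q_1; ...; q_k; q_(k+1)] with q_0 = vertex v, q_1..q_k reflection
   points on open sides, q_(k+1) a vertex, all open segments inside the
   triangle.  Its length is k, the number of reflections. *)
Definition gen_diag (a b : R) (v : 'I_3) (s : seq pt) : Prop :=
  let k := (size s - 2)%N in
  [/\ (2 <= size s)%N,
      nth (0, 0) s 0 = vtx a b v,
      exists w : 'I_3, nth (0, 0) s k.+1 = vtx a b w,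
      (forall j, (j <= k)%N -> seg_inside a b (nth (0,0) s j) (nth (0,0) s j.+1)) &
      (forall j, (1 <= j <= k)%N -> exists i : 'I_3,
          on_open_side a b i (nth (0,0) s j) /\
          reflection_law a b i (nth (0,0) s j.-1) (nth (0,0) s j) (nth (0,0) s j.+1))].

Definition diag_length (s : seq pt) : nat := (size s - 2)%N.

(* P_n(v): number of generalized diagonals of length at most n from v,
   as an extended real (the supremum of sizes of duplicate-free lists of such
   diagonals, i.e. the cardinality of that set, +oo if infinite). *)
Definition Pcount (a b : R) (n : nat) (v : 'I_3) : \bar R :=
  ereal_sup [set ((size L)%:R)%:E | L in
     [set L : seq (seq pt) | uniq L /\
        forall s, s \in L -> gen_diag a b v s /\ (diag_length s <= n)%N]].

Definition gap_property (a b : R) : Prop :=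
  forall (v : 'I_3) (mu : R), Num.sqrt 3 - 1 < mu ->
  let S := [set n : nat | (0 < n)%N /\
                 (Pcount a b n v < (expR ((n%:R : R) `^ mu))%:E)%E] in
  infinite_set S /\
  forall eps : R, 0 < eps -> exists N : nat, forall n : nat, S n -> (N <= n)%N ->
    exists m : nat, S m /\ (n < m)%N /\
      (m%:R - n%:R : R) < (n%:R : R) `^ (1 + eps).

End Billiard.

(* Main.v *)
Require Import Defs.
From HB Require Import structures.
From mathcomp Require Import all_boot all_order all_algebra.
From mathcomp Require Import all_classical all_reals all_analysis.
From mathcomp Require Import ring lra zify.
From mathcomp Require Import complex measurable_realfun.
Set Implicit Arguments. Unset Strict Implicit. Unset Printing Implicit Defensive.
Import Order.TTheory GRing.Theory Num.Theory.
Import numFieldNormedType.Exports.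
Local Open Scope classical_set_scope.
Local Open Scope ring_scope.

(* Idea.  A generalized diagonal from [v] unfolds to a segment from [v] to a
   vertex of a chain of reflected triangles, and is determined by the word of
   sides it crosses.  Cut the angle at [v] into M sectors.  In one sector the
   diagonals form a binary tree under the prefix order (beams separate only at
   vertices), and consecutive nodes u, w, c of a branch that turns from one
   side to the other have vertices that are not collinear; since the sector is
   thin they are collinear up to O(n^2/M).  In the frame of the triangle
   reached at u, their non-collinearity is a polynomial with integer
   coefficients in the cotangents of the two base angles, of degree O(g) when
   |c| - |u| <= g.  Outside a null set of triangles all such polynomials that
   do not vanish are at least exp(-O(g^2)), by a sublevel estimate and
   summation over the exponentially many words.  So with M = exp(O(g^2)) poly(n)
   a turn costs more than g reflections, and a sector holds at most
   (2n+2)^(n/g+1) diagonals: a straight run has at most n nodes.  Taking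
   g = n^(1/3) gives P_n(v) <= exp(O(n^(2/3) log n)), and 2/3 < sqrt 3 - 1, so
   for almost every triangle all large n lie in the set considered. *)

(** * Plane geometry of a beam *)

(** The lower bound must depend on the g letters from u to c and not on the n letters from v:
    bringing u back to the initial triangle discards the common past. A bound over whole words would
    only be exp(-O(n^2)), which is useless here. The square in exp(-O(g^2)) is a product of two
    linear losses: the distance t to the roots has to be exp(-O(g)) for the exceptional sets to be
    summable over the words, and a polynomial of bidegree d is only known to be at least t^(2d) away
    from the roots, with d of order g. The choice of g balances the g^2 of the number of sectors
    against the n/g turns in each of them. Cotangents serve as coordinates because vertices and
    reflections are rational in them over the integers, and because the arccotangent is 1-Lipschitz,
    so that estimates pass back to the angles without loss near degenerate triangles. *)

Section Plane.
Variable R : realType.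
Notation pt := (R * R)%type.
Implicit Types (o r l x d e : pt).

Lemma crossC x d : cross x d = - cross d x.
Proof. by rewrite /cross; ring. Qed.

(* Cramer's rule in the basis [d, e]. *)
Lemma cross_expand d e x r :
  cross d e * cross r x = cross x e * cross r d + cross d x * cross r e.
Proof. by rewrite /cross; ring. Qed.

Lemma cross_cone_gt0r d e x r : 0 < cross d e -> 0 < cross d x ->
  0 <= cross x e -> 0 <= cross r d -> 0 < cross r e -> 0 < cross r x.
Proof.
move=> de dx xe rd re; rewrite -(pmulr_rgt0 _ de) (cross_expand d e).
by rewrite ltr_wpDl ?mulr_ge0 ?mulr_gt0 // ltW.
Qed.

Lemma cross_cone_ge0_left d e x l : 0 < cross d e -> 0 <= cross d x ->
  0 <= cross x e -> 0 <= cross d l -> 0 <= cross e l -> 0 <= cross x l.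
Proof.
move=> de dx xe dl el; rewrite -(pmulr_rge0 _ de).
by rewrite [_ * _](_ : _ = cross x e * cross d l + cross d x * cross e l)
  ?addr_ge0 ?mulr_ge0 // /cross; ring.
Qed.

Lemma cross_cone_gt0_left d e x l : 0 < cross d e -> 0 < cross d x ->
  0 <= cross x e -> 0 <= cross d l -> 0 < cross e l -> 0 < cross x l.
Proof.
move=> de dx xe dl el; rewrite -(pmulr_rgt0 _ de).
rewrite [_ * _](_ : _ = cross x e * cross d l + cross d x * cross e l).
  by rewrite ltr_wpDl ?mulr_ge0 ?mulr_gt0.
by rewrite /cross; ring.
Qed.

(** Being counterclockwise is not transitive in the whole plane; the open half-plane to the left of
    [r] makes it so. *)
Lemma cross_trans r (x y z : pt) : 0 < cross r x -> 0 < cross r y ->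
  0 < cross r z -> 0 < cross x y -> 0 < cross y z -> 0 < cross x z.
Proof.
move=> rx ry rz xy yz; rewrite -(pmulr_rgt0 _ ry).
have -> : cross r y * cross x z = cross r z * cross x y + cross r x * cross y z.
  by rewrite /cross; ring.
by rewrite addr_gt0 // mulr_gt0.
Qed.

(* For [0 < cross r l], positive exactly on the side of the line [r l]
   that contains the origin. *)
Definition side r l x := cross (vsub l r) (vsub x r).

(** Within the half-plane to the left of [r], replacing the end [l] by a point [N] beyond the edge
    only enlarges the near side. *)
Lemma near_side_left r l (N x : pt) : 0 < cross r l -> side r l N < 0 ->
  0 < cross r N -> 0 <= cross r x -> 0 <= side r l x -> 0 <= side r N x.
Proof.
move=> rl bN rN rx bx; rewrite -(pmulr_rge0 _ rl).
have -> : cross r l * side r N x =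
  cross r N * side r l x + cross r x * - side r l N.
  by rewrite /side /cross /vsub /=; ring.
by rewrite addr_ge0 // mulr_ge0 ?(ltW rN) // oppr_ge0 ltW.
Qed.

Lemma near_side_right r l (N x : pt) : 0 < cross r l -> side r l N < 0 ->
  0 < cross N l -> 0 <= cross x l -> 0 <= side r l x -> 0 <= side N l x.
Proof.
move=> rl bN rN rx bx; rewrite -(pmulr_rge0 _ rl).
have -> : cross r l * side N l x =
  cross N l * side r l x + cross x l * - side r l N.
  by rewrite /side /cross /vsub /=; ring.
by rewrite addr_ge0 // mulr_ge0 ?(ltW rN) // oppr_ge0 ltW.
Qed.

(** In the basis [r], [l] a point beyond the line has coordinates of sum above 1. So if [cross r N]
    were nonpositive, [cross N l] would be positive and [N] would lie to the right of [x]. *)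
Lemma cross_right_beyond r l (N x : pt) : 0 < cross r l -> side r l N < 0 ->
  0 < cross r x -> 0 < cross x N -> 0 < cross x l -> 0 < cross r N.
Proof.
move=> rl bN rx xN xl; rewrite ltNge; apply/negP => rN.
have : cross N l + cross r N > cross r l.
  by move: bN; rewrite /side /cross /vsub /=; lra.
move=> h; have Nl : 0 < cross N l by lra.
have : cross r l * cross x N = cross N l * cross x r + cross r N * cross x l.
  exact: cross_expand.
have := mulr_gt0 rl xN; rewrite (crossC x r).
have := mulr_gt0 Nl rx; have : cross r N * cross x l <= 0.
  by rewrite mulr_le0_ge0 // ltW.
by rewrite mulrN; lra.
Qed.

Lemma cross_left_beyond r l (N x : pt) : 0 < cross r l -> side r l N < 0 ->
  0 < cross x l -> 0 < cross N x -> 0 < cross r x -> 0 < cross N l.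
Proof.
move=> rl bN xl Nx rx; rewrite ltNge; apply/negP => Nl.
have : cross N l + cross r N > cross r l.
  by move: bN; rewrite /side /cross /vsub /=; lra.
move=> h; have rN : 0 < cross r N by lra.
have : cross r l * cross N x = cross x l * cross N r + cross r x * cross N l.
  exact: cross_expand.
have := mulr_gt0 rl Nx; rewrite (crossC N r).
have := mulr_gt0 xl rN; have : cross r x * cross N l <= 0.
  by rewrite mulr_ge0_le0 // ltW.
by rewrite mulrN; lra.
Qed.

Definition sees (r l : nat -> pt) d m := 0 < cross (r m) d /\ 0 < cross d (l m).

Section ChainOpen.
Variables (r l N : nat -> pt) (k : nat) (d : pt).
Hypothesis first : 0 < cross (r 1) (l 1).
Hypothesis apex : forall m, (0 < m <= k)%N -> side (r m) (l m) (N m) < 0.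
Hypothesis step : forall m, (0 < m < k)%N ->
  (r m.+1 = N m /\ l m.+1 = l m) \/ (r m.+1 = r m /\ l m.+1 = N m).
Hypothesis seen : forall m, (0 < m <= k)%N -> sees r l d m.

(** Seen from the origin, the m-th edge crossed has ends [r m] and [l m], and [N m] is the apex of
    the triangle beyond it. [sees] alone allows an angle above pi from [r m] to [l m]; by induction
    from the first edge, an apex beyond a positively oriented edge cannot open it that far. *)
Lemma chain_open m : (0 < m <= k)%N -> 0 < cross (r m) (l m).
Proof.
elim: m => // -[_ _ //|m] IH mk.
have mk' : (0 < m.+1 <= k)%N := ltnW mk.
have rl := IH mk'; have bN := apex mk'.
have [rd dl] := seen mk'; have [rd' dl'] := seen mk.
case: (@step m.+1) => [|[Er El]|[Er El]]; first by case/andP: mk.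
  rewrite Er El; rewrite Er El in rd' dl'.
  exact: (cross_left_beyond rl bN dl' rd' rd).
rewrite Er El; rewrite Er El in rd' dl'.
exact: (cross_right_beyond rl bN rd' dl' dl).
Qed.
End ChainOpen.

Section Chain.
Variables (r l N : nat -> pt) (k1 k2 k3 : nat).
Hypotheses (k1_gt0 : (0 < k1)%N) (k12 : (k1 < k2)%N) (k23 : (k2 < k3)%N).

Hypothesis first : 0 < cross (r 1) (l 1).
Hypothesis apex : forall m, (0 < m <= k3)%N -> side (r m) (l m) (N m) < 0.
Hypothesis step : forall m, (0 < m < k3)%N ->
  (r m.+1 = N m /\ l m.+1 = l m) \/ (r m.+1 = r m /\ l m.+1 = N m).
Hypothesis sees3 : forall m, (0 < m <= k3)%N -> sees r l (N k3) m.
Hypothesis sees2 : forall m, (0 < m <= k2)%N -> sees r l (N k2) m.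
Hypothesis sees1 : forall m, (0 < m <= k1)%N -> sees r l (N k1) m.
Hypotheses (N13 : 0 < cross (N k1) (N k3)) (N32 : 0 < cross (N k3) (N k2)).
Hypothesis unobstructed : forall m, (k1 < m < k2)%N ->
  0 < cross (N k1) (N m) -> 0 < cross (N m) (N k2) ->
  ~ (forall j, (0 < j <= m)%N -> sees r l (N m) j).

(** Backwards from [k3]: since the next edge only enlarges the near side, a point on the near side
    of one edge would stay on the near side of the next. *)
Lemma chain_last_beyond m : (0 < m <= k3)%N -> side (r m) (l m) (N k3) < 0.
Proof.
move=> /andP[m0 mk].
have := subnK mk; move: (k3 - m)%N => j; elim: j m m0 mk => [|j IH] m m0 mk jm.
  by move: jm; rewrite add0n => e; rewrite -e; apply: apex; rewrite m0.
have mk1 : (0 < m.+1 <= k3)%N by rewrite -jm addSn !ltnS leq_addl.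
have mk' : (0 < m <= k3)%N by rewrite m0.
have rl := chain_open first apex step sees3 mk'; have bN := apex mk'.
have rl1 := chain_open first apex step sees3 mk1.
have [rd dl] := sees3 mk'.
have := IH m.+1 isT mk1; rewrite addnS -addSn jm => /(_ erefl); rewrite !ltNge; apply: contra => sd.
case: (@step m) => [|[Er El]|[Er El]]; first by rewrite m0.
  by rewrite Er El in rl1 *; apply: near_side_right rl bN rl1 (ltW dl) sd.
by rewrite Er El in rl1 *; apply: near_side_left rl bN rl1 (ltW rd) sd.
Qed.

Lemma sector_open : 0 < cross (N k1) (N k2).
Proof.
have [r3 l3] : sees r l (N k3) 1 by apply: sees3; lia.
have [r1 l1] : sees r l (N k1) 1 by apply: sees1; lia.
have [r2 l2] : sees r l (N k2) 1 by apply: sees2; lia.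
rewrite -(pmulr_rgt0 _ r3).
have -> : cross (r 1) (N k3) * cross (N k1) (N k2) =
   cross (r 1) (N k2) * cross (N k1) (N k3) + cross (r 1) (N k1) * cross (N k3) (N k2).
  by rewrite /cross; ring.
by rewrite addr_gt0 // mulr_gt0.
Qed.

(** Just after [k1] the right end is [N k1], because [N k3] lies to its left. A later right end to
    the left of [N k1] would be a vertex seen between [N k1] and [N k2], which [unobstructed]
    forbids. *)
Lemma chain_first_near m : (k1 < m <= k2.+1)%N ->
  [/\ 0 <= cross (r m) (N k1), 0 <= cross (N k1) (l m) &
      0 <= side (r m) (l m) (N k1)].
Proof.
have N12 := sector_open.
elim/ltn_ind: m => -[//|m] IH /andP[]; rewrite !ltnS => k1m mk2.
have m0 : (0 < m)%N := leq_trans k1_gt0 k1m.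
have mk3 : (m < k3)%N := leq_ltn_trans mk2 k23.
have mk1 : (0 < m.+1 <= k3)%N by [].
have m0k3 : (0 < m < k3)%N by rewrite m0.
have mk0 : (0 < m <= k3)%N by rewrite m0 ltnW.
have [r3 l3] := sees3 mk1; have rl1 := chain_open first apex step sees3 mk1.
have := k1m; rewrite leq_eqVlt => /orP[/eqP e|km].
  case: (step m0k3) => -[Er El].
    rewrite Er -e in rl1 *; split; first by rewrite /cross mulrC subrr.
      exact: ltW.
    by rewrite /side /cross /vsub /= !subrr !mulr0 subrr.
  by exfalso; move: l3; rewrite El -e crossC oppr_gt0 ltNge ltW.
have rl := chain_open first apex step sees3 mk0; have bN := apex mk0.
have [|rN1 N1l sN1] := IH m (ltnSn m); first by rewrite km leqW.
have := mk2; rewrite leq_eqVlt => /orP[/eqP e|km2].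
  case: (step m0k3) => -[Er El].
    by exfalso; move: r3; rewrite Er e crossC oppr_gt0 ltNge ltW.
  rewrite Er El in rl1 *; rewrite {2}e; split => //; first exact: ltW.
  exact: near_side_left sN1.
have [r2 l2] := @sees2 m.+1 km2.
case: (step m0k3) => -[Er El].
  rewrite Er El in rl1 r2 *.
  have rN1' : 0 <= cross (N m) (N k1).
    rewrite leNgt; apply/negP => Nm1.
    have N1m : 0 < cross (N k1) (N m) by rewrite crossC oppr_gt0.
    apply: (@unobstructed m _ N1m r2) => [|j /andP[j0 jm]]; first by rewrite km.
    have [rj lj] : sees r l (N k2) j by apply: sees2; rewrite j0 (leq_trans jm).
    have [rj1 lj1] : 0 <= cross (r j) (N k1) /\ 0 <= cross (N k1) (l j).
      have [jk|jk] := leqP j k1.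
        by have [/ltW ? /ltW ?] : sees r l (N k1) j by apply: sees1; rewrite j0.
      by have [] := IH j jm; rewrite // jk (leq_trans jm) // leqW.
    split; first exact: (cross_cone_gt0r N12 N1m (ltW r2)).
    exact: (cross_cone_gt0_left N12 N1m (ltW r2)).
  by split => //; apply: near_side_right sN1.
rewrite Er El in rl1 r2 l2 *; split => //; last exact: near_side_left sN1.
exact: (cross_cone_ge0_left r2 rN1 (ltW N12) (ltW rl1) (ltW l2)).
Qed.

(* The edge crossed just after passing [N k2] ends there and has [N k1] on
   its near side and [N k3] on its far side. *)
Lemma chain_not_collinear :
  cross (vsub (N k3) (N k1)) (vsub (N k2) (N k1)) != 0.
Proof.
have [|rN1 _ sN1] := @chain_first_near k2.+1; first by rewrite leqnn ltnW.
have k2k3 : (0 < k2.+1 <= k3)%N by [].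
have sN3 := chain_last_beyond k2k3.
have [r3 l3] := sees3 k2k3.
case: (@step k2) => [|[Er El]|[Er El]]; first by rewrite k23 (leq_trans _ k12).
  by exfalso; move: r3; rewrite Er crossC oppr_gt0 ltNge ltW.
rewrite Er El in sN1 sN3; apply/eqP => col.
have N12 := sector_open.
(* If the three were collinear, [N k1] and [N k3], both to the right of the direction [N k2], would
   lie on the same ray of their line from [N k2], hence on the same side of the edge. *)
have : cross (N k1) (N k2) * side (r k2) (N k2) (N k3) =
    cross (N k3) (N k2) * side (r k2) (N k2) (N k1) -
    cross (vsub (N k3) (N k1)) (vsub (N k2) (N k1)) * cross (r k2) (N k2).
  by rewrite /side /cross /vsub /=; ring.
rewrite col mul0r subr0.
by move/eqP; rewrite lt_eqF // (lt_le_trans _ (mulr_ge0 (ltW N32) sN1)) // pmulr_rlt0.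
Qed.
End Chain.

(** Exchanges left and right, so that turns in only one sense need an argument. *)
Definition mirror (x : pt) : pt := (- x.1, x.2).

Lemma cross_mirror x d : cross (mirror x) (mirror d) = cross d x.
Proof. by rewrite /cross /mirror /=; ring. Qed.

Lemma mirror_vsub x d : vsub (mirror x) (mirror d) = mirror (vsub x d).
Proof. by rewrite /vsub /mirror /=; congr pair; ring. Qed.

Lemma side_mirror r l x : side (mirror l) (mirror r) (mirror x) = side r l x.
Proof. by rewrite /side /cross /vsub /=; ring. Qed.

End Plane.

(** * Unfolding *)

Lemma nextv3 i : nextv (nextv (nextv i)) = i.
Proof. by apply: val_inj; case: i => -[|[|[|]]]. Qed.

Lemma ord3_cases (i j : 'I_3) : [\/ j = i, j = nextv i | j = nextv (nextv i)].
Proof.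
case: i j => -[|[|[|//]]] Hi [[|[|[|//]]] Hj];
  by [constructor 1; apply: val_inj | constructor 2; apply: val_inj
     | constructor 3; apply: val_inj].
Qed.

Section Unfolding.
Variable R : realType.
Notation pt := (R * R)%type.
Variable V : 'I_3 -> pt.

Definition edge i := vsub (V (nextv i)) (V i).
Definition area2 i := cross (edge i) (vsub (V (nextv (nextv i))) (V i)).

Lemma area2_nextv i : area2 (nextv i) = area2 i.
Proof. by rewrite /area2 /edge nextv3 /cross /vsub /=; ring. Qed.

Lemma area2E i j : area2 i = area2 j.
Proof. by case: (ord3_cases j i) => ->; rewrite ?area2_nextv. Qed.

Hypothesis area_gt0 : 0 < area2 ord0.

Lemma area2_gt0 i : 0 < area2 i.
Proof. by rewrite (area2E i ord0). Qed.

Lemma edge_neq0 i : dot (edge i) (edge i) != 0.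
Proof.
apply: contraTneq (area2_gt0 i) => e0.
have [e1 e2] : (edge i).1 = 0 /\ (edge i).2 = 0.
  move/eqP: e0; rewrite /dot -!expr2 paddr_eq0 ?sqr_ge0 // !sqrf_eq0.
  by case/andP => /eqP -> /eqP ->.
by rewrite /area2 /cross e1 e2 !mul0r subrr ltxx.
Qed.

(** The linear part of [unf]. The first side crossed is outermost: reflecting a copy in its own side
    means reflecting the original triangle and then moving it to the copy. *)
Definition unfl c d := foldr (fun i => Defs.reflect (edge i)) d c.
Definition refl i x := vadd (V i) (Defs.reflect (edge i) (vsub x (V i))).

(* [unf [:: i1; ...; ik] x]: the position of the point [x] of the triangle
   in the copy reached after crossing the sides [i1], ..., [ik]. *)
Definition unf c x := foldr refl x c.

Lemma unf_cat c1 c2 x : unf (c1 ++ c2) x = unf c1 (unf c2 x).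
Proof. exact: foldr_cat. Qed.

Lemma unf_rcons c i x : unf (rcons c i) x = unf c (refl i x).
Proof. by rewrite -cats1 unf_cat. Qed.

Lemma unfl_rcons c i x : unfl (rcons c i) x = unfl c (Defs.reflect (edge i) x).
Proof. by rewrite /unfl -cats1 foldr_cat. Qed.

Lemma vsub_unf c x y : vsub (unf c x) (unf c y) = unfl c (vsub x y).
Proof.
elim: c => //= i c IH; rewrite -{}IH.
have := edge_neq0 i; rewrite /refl; move: (edge i) => u u0.
by rewrite /Defs.reflect /vadd /vsub /vscale /dot /= in u0 *; congr pair; field.
Qed.

Lemma unfl_scale c t d : unfl c (vscale t d) = vscale t (unfl c d).
Proof.
elim: c => //= i c ->; rewrite /Defs.reflect /vsub /vscale /dot /=.
by congr pair; ring.
Qed.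

Lemma cross_unfl c d e : cross (unfl c d) (unfl c e) = (-1) ^+ size c * cross d e.
Proof.
elim: c => [|i c IH] /=; first by rewrite mul1r.
rewrite exprS -mulrA -{}IH.
have := edge_neq0 i; move: (edge i) => u u0.
by rewrite /cross /Defs.reflect /vsub /vscale /dot /= in u0 *; field.
Qed.

Lemma dot_unfl c d e : dot (unfl c d) (unfl c e) = dot d e.
Proof.
elim: c => [//|i c IH] /=; rewrite -{}IH.
have := edge_neq0 i; move: (edge i) => u u0.
by rewrite /Defs.reflect /vsub /vscale /dot /= in u0 *; field.
Qed.

Lemma reflect_involutive i d : Defs.reflect (edge i) (Defs.reflect (edge i) d) = d.
Proof.
have := edge_neq0 i; move: (edge i) => u u0; rewrite [RHS]surjective_pairing.
by rewrite /Defs.reflect /vsub /vscale /dot /= in u0 *; congr pair; field.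
Qed.

Lemma refl_line i s : refl i (vadd (V i) (vscale s (edge i))) =
  vadd (V i) (vscale s (edge i)).
Proof.
have := edge_neq0 i; rewrite /refl; move: (edge i) => u u0.
by rewrite /Defs.reflect /vadd /vsub /vscale /dot /= in u0 *; congr pair; field.
Qed.

Lemma refl_start i : refl i (V i) = V i.
Proof.
rewrite -[X in refl i X](_ : vadd (V i) (vscale 0 (edge i)) = V i).
  by rewrite refl_line; case: (V i) => x y; rewrite /vadd /vscale /= !mul0r !addr0.
by case: (V i) => x y; rewrite /vadd /vscale /= !mul0r !addr0.
Qed.

Lemma refl_end i : refl i (V (nextv i)) = V (nextv i).
Proof.
have e : vadd (V i) (vscale 1 (edge i)) = V (nextv i).
  rewrite [RHS]surjective_pairing /vadd /vscale /edge /vsub /=.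
  by congr pair; ring.
by rewrite -e refl_line.
Qed.

Variable v : 'I_3.
Implicit Types (c : seq 'I_3) (d : pt).

(** A side is fixed by its own reflection, so the full word can place the side it crossed last. Each
    reflection reverses orientation, hence the parity test for which end is on the right. *)
Definition endr c := let i := last ord0 c in
  vsub (unf c (V (if odd (size c) then i else nextv i))) (V v).
Definition endl c := let i := last ord0 c in
  vsub (unf c (V (if odd (size c) then nextv i else i))) (V v).
Definition tip c := vsub (unf c (V (nextv (nextv (last ord0 c))))) (V v).

Lemma vsub_vsub (x y z : pt) : vsub (vsub x z) (vsub y z) = vsub x y.
Proof. by rewrite /vsub /=; congr pair; ring. Qed.

Lemma tip_beyond c : side (endr c) (endl c) (tip c) < 0.
Proof.
rewrite /side /endr /endl /tip !vsub_vsub !vsub_unf cross_unfl -signr_odd.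
have := area2_gt0 (last ord0 c); rewrite /area2 /edge.
case: odd; rewrite /= /cross /vsub /=; lra.
Qed.

Lemma ends_rcons c i : i != last ord0 c ->
  (endr (rcons c i) = tip c /\ endl (rcons c i) = endl c) \/
  (endr (rcons c i) = endr c /\ endl (rcons c i) = tip c).
Proof.
rewrite /endr /endl /tip last_rcons size_rcons /= !unf_rcons.
case: (ord3_cases (last ord0 c) i) => ->; rewrite ?eqxx // => _;
  by case: odd => /=; rewrite ?refl_start ?refl_end ?nextv3; auto.
Qed.

Lemma ends_rcons_eq c : endr (rcons c (last ord0 c)) = endl c /\
  endl (rcons c (last ord0 c)) = endr c.
Proof.
rewrite /endr /endl last_rcons size_rcons /= !unf_rcons.
by case: odd => /=; rewrite refl_start refl_end.
Qed.

Lemma ends1_gt0 : 0 < cross (endr [:: nextv v]) (endl [:: nextv v]).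
Proof.
rewrite /endr /endl /= refl_start refl_end.
by have := area2_gt0 v; rewrite /area2 /edge.
Qed.

(** Crossing the sides of [c] is expressed by angles only, without points of intersection; this
    makes the condition convex in the direction [d]. *)
Definition meets c d := forall m, (0 < m <= size c)%N ->
  0 < cross (endr (take m c)) d /\ 0 < cross d (endl (take m c)).

Lemma meets_take c d m : meets c d -> meets (take m c) d.
Proof.
move=> cd j /andP[j0]; rewrite size_take_min leq_min => /andP[jm jc].
by rewrite take_takel // ; apply: cd; rewrite j0.
Qed.

Lemma meets_head c d : meets c d -> c != [::] -> head ord0 c = nextv v.
Proof.
case: c => //= i c cd _; have [] := cd 1%N isT; rewrite /=.
rewrite take0 /endr /endl /= refl_start refl_end.
case: (ord3_cases v i) => -> //=; first by rewrite /cross /vsub /= !subrr !mul0r subrr ltxx.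
by rewrite nextv3 => _; rewrite /cross /vsub /= !subrr !mulr0 subrr ltxx.
Qed.

Lemma crossC_lt0 (x y : pt) : (cross x y < 0) = (0 < cross y x).
Proof. by rewrite crossC oppr_lt0. Qed.

(** Crossing the same side twice in a row exchanges the ends of the edge and so reverses the strict
    inequalities. *)
Lemma meets_neq c d m : meets c d -> (0 < m < size c)%N ->
  nth ord0 c m != last ord0 (take m c).
Proof.
move=> cd /andP[m0 mc]; apply/eqP => e.
have [] := cd m.+1 mc; rewrite (take_nth ord0) // e.
have [-> ->] := ends_rcons_eq (take m c).
have [|h _] := cd m; first by rewrite m0 ltnW.
by move=> _; rewrite -crossC_lt0 => h'; have := lt_trans h h'; rewrite ltxx.
Qed.

Lemma meets_step c d m : meets c d -> (0 < m < size c)%N ->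
  (endr (take m.+1 c) = tip (take m c) /\ endl (take m.+1 c) = endl (take m c)) \/
  (endr (take m.+1 c) = endr (take m c) /\ endl (take m.+1 c) = tip (take m c)).
Proof.
move=> cd mc; rewrite (take_nth ord0); last by case/andP: mc.
exact/ends_rcons/(meets_neq cd).
Qed.

Lemma meets_first c d : meets c d -> (0 < size c)%N ->
  0 < cross (endr (take 1 c)) (endl (take 1 c)).
Proof.
case: c => // i c cd _; have /= -> := meets_head cd isT; rewrite /=.
by rewrite take0; apply: ends1_gt0.
Qed.

Lemma meets_open c d m : meets c d -> (0 < m <= size c)%N ->
  0 < cross (endr (take m c)) (endl (take m c)).
Proof.
move=> cd mc; have [m0 mc'] := andP mc.
apply: (@chain_open _ (fun j => endr (take j c)) (fun j => endl (take j c))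
  (fun j => tip (take j c)) (size c)) mc.
- exact: meets_first cd (leq_trans m0 mc').
- by move=> j _; apply: tip_beyond.
- by move=> j; apply: meets_step cd.
- exact: cd.
Qed.

(** The condition satisfied by the word of a generalized diagonal. The empty word is excluded
    because a segment between two vertices runs along a side. *)
Definition admissible c := c != [::] /\ meets c (tip c).

Lemma admissible_first c : admissible c ->
  (0 < size c)%N /\ take 1 c = [:: nextv v].
Proof.
move=> [c0 cc]; have := meets_head cc c0.
by case: c c0 {cc} => //= i c _ ->; rewrite take0.
Qed.

Lemma admissible_cone c : admissible c ->
  0 < cross (endr [:: nextv v]) (tip c) /\ 0 < cross (tip c) (endl [:: nextv v]).
Proof.
move=> ac; have [c0 e1] := admissible_first ac.
by have := ac.2 1%N c0; rewrite e1.
Qed.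

Definition between d1 d2 d :=
  (0 < cross d1 d /\ 0 < cross d d2) \/ (0 < cross d2 d /\ 0 < cross d d1).

Lemma meets_between c d1 d2 d : meets c d1 -> meets c d2 ->
  0 < cross d1 d2 -> 0 < cross d1 d -> 0 < cross d d2 -> meets c d.
Proof.
move=> c1 c2 d12 d1d dd2 m mc; have [r1 l1] := c1 m mc; have [r2 l2] := c2 m mc.
split; first exact: (cross_cone_gt0r d12 d1d (ltW dd2) (ltW r1)).
exact: (cross_cone_gt0_left d12 d1d (ltW dd2) (ltW l1)).
Qed.

Lemma ends_rcons2 c i j : i != last ord0 c -> j != last ord0 c -> i != j ->
  [/\ endr (rcons c i) = tip c, endl (rcons c i) = endl c,
      endr (rcons c j) = endr c & endl (rcons c j) = tip c] \/
  [/\ endr (rcons c j) = tip c, endl (rcons c j) = endl c,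
      endr (rcons c i) = endr c & endl (rcons c i) = tip c].
Proof.
rewrite /endr /endl /tip !last_rcons !size_rcons /= !unf_rcons.
case: (ord3_cases (last ord0 c) i) => ->; rewrite ?eqxx // => _;
case: (ord3_cases (last ord0 c) j) => ->; rewrite ?eqxx // => _ _;
by case: odd => /=; rewrite ?refl_start ?refl_end ?nextv3; ((by left) || (by right)).
Qed.

Lemma branching_ordered c1 c2 m : admissible c1 -> admissible c2 ->
  (0 < m < size c1)%N -> (0 < m < size c2)%N -> take m c1 = take m c2 ->
  endl (take m.+1 c1) = tip (take m c1) -> endr (take m.+1 c2) = tip (take m c1) ->
  [/\ admissible (take m c1), 0 < cross (tip c1) (tip (take m c1)) &
      0 < cross (tip (take m c1)) (tip c2)].
Proof.
move=> a1 a2 /andP[m0 m1] /andP[_ m2] e12 el er.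
have [|r1 l1] := a1.2 m; first by rewrite m0 ltnW.
have [|r2 l2] := a2.2 m; first by rewrite m0 ltnW.
have [_] := a1.2 m.+1 m1; have [+ _] := a2.2 m.+1 m2.
rewrite -e12 in r2 l2; rewrite el er => N2 N1.
have rl : 0 < cross (endr (take m c1)) (endl (take m c1)).
  by apply: meets_open a1.2 _; rewrite m0 ltnW.
have rN := cross_right_beyond rl (tip_beyond _) r1 N1 l1.
split=> //; split; first by rewrite -size_eq0 size_take m1 -lt0n.
apply: meets_between (cross_trans r1 rN r2 N1 N2) N1 N2.
  exact: meets_take a1.2.
by rewrite e12; apply: meets_take a2.2.
Qed.

(** Where the words first differ, the rays pass on either side of the apex of the last common
    triangle, which is therefore seen between them through all common edges. *)
Lemma branching c1 c2 m : admissible c1 -> admissible c2 ->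
  (m < size c1)%N -> (m < size c2)%N -> take m c1 = take m c2 ->
  nth ord0 c1 m != nth ord0 c2 m ->
  admissible (take m c1) /\ between (tip c1) (tip c2) (tip (take m c1)).
Proof.
move=> a1 a2 m1 m2 e12 n12; case: (posnP m) => [m0|m0].
  move: n12; rewrite m0 !nth0.
  by rewrite (meets_head a1.2 a1.1) (meets_head a2.2 a2.1) eqxx.
have h1 : (0 < m < size c1)%N by rewrite m0.
have h2 : (0 < m < size c2)%N by rewrite m0.
have := meets_neq a2.2 h2; have := meets_neq a1.2 h1; rewrite -e12 => n1 n2.
have t1 : take m.+1 c1 = rcons (take m c1) (nth ord0 c1 m) by rewrite -take_nth.
have t2 : take m.+1 c2 = rcons (take m c1) (nth ord0 c2 m).
  by rewrite e12 -take_nth.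
case: (ends_rcons2 n1 n2 n12); rewrite -t1 -t2 => -[er _ _ el].
  have [] := branching_ordered a2 a1 h2 h1 (esym e12); rewrite -e12 // => ap ? ?.
  by split=> //; right.
by have [] := branching_ordered a1 a2 h1 h2 e12 el er => ap ? ?; split=> //; left.
Qed.

Lemma first_difference c1 c2 : (size c1 <= size c2)%N ->
  c1 = take (size c1) c2 \/ exists2 m, (m < size c1)%N &
    take m c1 = take m c2 /\ nth ord0 c1 m != nth ord0 c2 m.
Proof.
elim: c1 c2 => [|x c1 IH] [|y c2] //=; rewrite ?take0; auto.
rewrite ltnS => /IH; have [->|xy] := eqVneq x y; last by right; exists 0%N.
case=> [{1}->|[m mc [e n]]]; first by left.
by right; exists m.+1 => //=; rewrite e.
Qed.

Lemma prefix_or_branch c1 c2 : admissible c1 -> admissible c2 ->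
  (size c1 <= size c2)%N -> c1 = take (size c1) c2 \/
  exists2 c, admissible c & (size c < size c1)%N /\ between (tip c1) (tip c2) (tip c).
Proof.
move=> a1 a2 s12; case: (first_difference s12) => [|[m mc [e n]]]; first by left.
right; have [ap b] := branching a1 a2 mc (leq_trans mc s12) e n.
by exists (take m c1) => //; rewrite size_take mc.
Qed.

Lemma betweenC d1 d2 d : between d1 d2 d -> between d2 d1 d.
Proof. by case; [right | left]. Qed.

Lemma between_neq (d1 d2 d : pt) :
  0 < cross (endr [:: nextv v]) d1 -> 0 < cross (endr [:: nextv v]) d2 ->
  0 < cross (endr [:: nextv v]) d -> between d1 d2 d -> cross d1 d2 != 0.
Proof.
move=> r1 r2 rd [[h1 h2]|[h1 h2]].
  by rewrite gt_eqF // (cross_trans r1 rd r2).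
by rewrite lt_eqF // crossC_lt0 (cross_trans r2 rd r1).
Qed.

(** If one word extends the other, the shorter tip is an end of the next edge, which the longer ray
    crosses strictly inside. Otherwise the branching apex separates the directions. *)
Lemma admissible_neq c1 c2 : admissible c1 -> admissible c2 -> c1 != c2 ->
  cross (tip c1) (tip c2) != 0.
Proof.
wlog s12 : c1 c2 / (size c1 <= size c2)%N.
  move=> wl a1 a2 n; case/orP: (leq_total (size c1) (size c2)) => h.
    exact: wl.
  by rewrite crossC oppr_eq0 wl // eq_sym.
move=> a1 a2 n12; case: (prefix_or_branch a1 a2 s12) => [e|[c ac [_ b]]]; last first.
  by apply: between_neq b; [case: (admissible_cone a1) | case: (admissible_cone a2)
    | case: (admissible_cone ac)].
have m12 : (0 < size c1 < size c2)%N.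
  rewrite (admissible_first a1).1 ltn_neqAle s12 andbT; apply: contra n12.
  by move=> /eqP h; rewrite {1}e h take_size.
have [r2 l2] : _ /\ _ := a2.2 (size c1).+1 ltac:(by case/andP: m12).
case: (meets_step a2.2 m12) => -[er el]; move: r2 l2; rewrite er el -e.
  by move=> r _; rewrite gt_eqF.
by move=> _ l; rewrite lt_eqF // crossC_lt0.
Qed.

Lemma between_trans_l (d1 d2 d3 d : pt) :
  0 < cross (endr [:: nextv v]) d1 -> 0 < cross (endr [:: nextv v]) d2 ->
  0 < cross (endr [:: nextv v]) d3 -> 0 < cross (endr [:: nextv v]) d ->
  between d1 d2 d3 -> between d1 d3 d -> between d1 d2 d.
Proof.
move: (endr _) => r r1 r2 r3 rd.
have tr x y z := @cross_trans _ r x y z.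
case=> -[h1 h2] [] [h3 h4].
- by left; split=> //; apply: (tr _ d3).
- by have := tr _ _ _ r3 rd r1 h3 h4; rewrite -crossC_lt0 => /(lt_trans h1); rewrite ltxx.
- by have := tr _ _ _ r1 rd r3 h3 h4; rewrite -crossC_lt0 => /(lt_trans h2); rewrite ltxx.
- by right; split=> //; apply: (tr _ d3).
Qed.

(** The minimality of [c3] is used twice: a branching apex would be shorter than [c3] and lie
    between the first two tips, so the words are prefixes of one another; and no vertex obstructs
    the view in the sense of [chain_not_collinear]. *)
Lemma triple_not_collinear c1 c2 c3 :
  admissible c1 -> admissible c2 -> admissible c3 ->
  (size c1 < size c2)%N -> (size c2 < size c3)%N ->
  between (tip c1) (tip c2) (tip c3) ->
  (forall c, admissible c -> between (tip c1) (tip c2) (tip c) ->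
    (size c3 <= size c)%N) ->
  [/\ c1 = take (size c1) c3, c2 = take (size c2) c3 &
  cross (vsub (tip c3) (tip c1)) (vsub (tip c2) (tip c1)) != 0].
Proof.
move=> a1 a2 a3 s12 s23 b3 bmin.
have s13 := ltn_trans s12 s23.
have cone c : admissible c -> 0 < cross (endr [:: nextv v]) (tip c).
  by case/admissible_cone.
have pre c c' : admissible c -> admissible c' -> (size c < size c')%N ->
   (size c < size c3)%N ->
   (forall w, admissible w -> between (tip c) (tip c') (tip w) ->
      between (tip c1) (tip c2) (tip w)) -> c = take (size c) c'.
  move=> a a' s s3 h; case: (prefix_or_branch a a' (ltnW s)) => // -[d ad [sd b]].
  by have := leq_ltn_trans (bmin d ad (h d ad b)) sd; rewrite ltnNge ltnW.
have e12 : c1 = take (size c1) c2 by apply: pre.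
have e13 : c1 = take (size c1) c3.
  apply: pre => // d ad b; apply: between_trans_l b3 b; exact: cone.
have e23 : c2 = take (size c2) c3.
  apply: pre => // d ad b; apply: betweenC; apply: between_trans_l (betweenC b3) b; exact: cone.
split=> //; have c0 := (admissible_first a1).1.
pose r m := endr (take m c3); pose l m := endl (take m c3); pose N m := tip (take m c3).
have fst : 0 < cross (r 1%N) (l 1%N) by apply: meets_first a3.2 (leq_trans c0 (ltnW s13)).
have step m : (0 < m < size c3)%N ->
  (r m.+1 = N m /\ l m.+1 = l m) \/ (r m.+1 = r m /\ l m.+1 = N m).
  exact: meets_step a3.2.
have apx m : side (r m) (l m) (N m) < 0 by apply: tip_beyond.
have sees_pre c m : admissible c -> c = take (size c) c3 -> (0 < m <= size c)%N ->
    sees r l (tip c) m.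
  move=> ac ec mc; rewrite /sees /r /l -(take_takel (j := size c)).
    by rewrite -ec; apply: ac.2.
  by case/andP: mc.
have N1 : N (size c1) = tip c1 by rewrite /N -e13.
have N2 : N (size c2) = tip c2 by rewrite /N -e23.
have N3 : N (size c3) = tip c3 by rewrite /N take_size.
have sees1 m : (0 < m <= size c1)%N -> sees r l (N (size c1)) m.
  by rewrite N1; apply: sees_pre.
have sees2 m : (0 < m <= size c2)%N -> sees r l (N (size c2)) m.
  by rewrite N2; apply: sees_pre.
have sees3 m : (0 < m <= size c3)%N -> sees r l (N (size c3)) m.
  by rewrite N3; apply: sees_pre; rewrite ?take_size.
have unobs m : (size c1 < m < size c2)%N -> between (tip c1) (tip c2) (N m) ->
    ~ (forall j, (0 < j <= m)%N -> sees r l (N m) j).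
  move=> /andP[m1 m2] b seen.
  have m3 := ltn_trans m2 s23.
  have am : admissible (take m c3).
    split; first by rewrite -size_eq0 size_take m3 -lt0n (ltn_trans _ m1).
    move=> j; rewrite size_take m3 => jm; have := seen j jm.
    by rewrite /sees /r /l /N take_takel //; case/andP: jm.
  by have := bmin _ am b; rewrite size_take m3 leqNgt m3.
case: b3 => -[b31 b32].
  rewrite -N1 -N2 -N3; apply: (chain_not_collinear c0 s12 s23 fst) => //.
  - by rewrite N1 N3.
  - by rewrite N2 N3.
  - by move=> m mc; rewrite N1 N2 => h1 h2; apply: unobs => //; left.
pose r' m := mirror (l m); pose l' m := mirror (r m); pose N' m := mirror (N m).
have sees_mirror d m : sees r l d m -> sees r' l' (mirror d) m.
  by rewrite /sees /r' /l' !cross_mirror => -[].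
have -> : cross (vsub (tip c3) (tip c1)) (vsub (tip c2) (tip c1)) =
  - cross (vsub (N' (size c3)) (N' (size c1))) (vsub (N' (size c2)) (N' (size c1))).
  by rewrite !mirror_vsub cross_mirror -crossC N1 N2 N3.
rewrite oppr_eq0; apply: (@chain_not_collinear _ r' l' N' _ _ _ c0 s12 s23).
- by rewrite /r' /l' cross_mirror.
- by move=> m _; rewrite /r' /l' side_mirror.
- move=> m /step; rewrite /r' /l' /N'.
  by case=> -[-> ->]; [right|left].
- by move=> m /sees3/sees_mirror.
- by move=> m /sees2/sees_mirror.
- by move=> m /sees1/sees_mirror.
- by rewrite /N' cross_mirror N1 N3.
- by rewrite /N' cross_mirror N2 N3.
- move=> m mc; rewrite /N' !cross_mirror N1 N2 => h1 h2 seen; apply: (unobs m mc).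
    by right.
  by move=> j jm; have := seen j jm; rewrite /sees /r' /l' !cross_mirror => -[].
Qed.

End Unfolding.

(** * Coding generalized diagonals by admissible words *)

Section GeneralizedDiagonals.
Variables (R : realType) (a b : R).
Notation pt := (R * R)%type.
Hypotheses (a_gt0 : 0 < a) (b_gt0 : 0 < b) (ab_pi : a + b < pi).
Notation V := (vtx a b).

Lemma sin_a_gt0 : 0 < sin a.
Proof. by apply: sin_gt0_pi; rewrite a_gt0 (lt_trans _ ab_pi) // ltrDl. Qed.

Lemma sin_b_gt0 : 0 < sin b.
Proof. by apply: sin_gt0_pi; rewrite b_gt0 (lt_trans _ ab_pi) // ltrDr. Qed.

Lemma sin_ab_gt0 : 0 < sin (a + b).
Proof. by apply: sin_gt0_pi; rewrite addr_gt0. Qed.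

Lemma vtx_area_gt0 : 0 < area2 V ord0.
Proof.
rewrite /area2 /edge /cross /vtx /vsub /= !subr0 mul0r subr0 mul1r.
by rewrite mulr_gt0 ?divr_gt0 ?sin_a_gt0 ?sin_b_gt0 ?sin_ab_gt0.
Qed.
Let area_gt0 := vtx_area_gt0.

(** The midpoint suffices: when one end lies on the line of side [i], it puts the other strictly on
    the inner side. *)
Lemma seg_inside_side (p q : pt) i : seg_inside a b p q ->
  0 < cross (edge V i) (vsub p (V i)) + cross (edge V i) (vsub q (V i)).
Proof.
have h2 : 0 < (2^-1 : R) < 1 by apply/andP; split; lra.
move=> /(_ _ h2 i); rewrite -/(edge V i) /cross /vsub /vadd /vscale /=; lra.
Qed.

Variable v : 'I_3.

Lemma open_side_on_line i (q : pt) : on_open_side a b i q ->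
  cross (edge V i) (vsub q (V i)) = 0.
Proof. by move=> [s [_ ->]]; rewrite -/(edge V i) /cross /vsub /vadd /vscale /=; ring. Qed.

Lemma refl_open_side i (q : pt) : on_open_side a b i q -> refl V i q = q.
Proof. by move=> [s [_ ->]]; apply: refl_line. Qed.

Lemma cross_edge_end i : cross (edge V i) (vsub (V (nextv i)) (V i)) = 0.
Proof. by rewrite /edge /cross mulrC subrr. Qed.

Lemma cross_edge_start i : cross (edge V i) (vsub (V i) (V i)) = 0.
Proof. by rewrite /cross /vsub /= !subrr !mulr0 subrr. Qed.

(* [c] lists the sides hit by [s], and all the points of [s] unfold onto the
   ray from [v] through the unfolded endpoint. *)
Definition coded (s : seq pt) (c : seq 'I_3) :=
  [/\ size s = (size c).+2, nth (0, 0) s 0 = V v,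
      nth (0, 0) s (size c).+1 = V (nextv (nextv (last ord0 c))) &
      forall j, (j < size c)%N ->
        on_open_side a b (nth ord0 c j) (nth (0, 0) s j.+1) /\
        cross (vsub (unf V (take j c) (nth (0, 0) s j.+1)) (V v)) (tip V v c) = 0].

(** Each reflection point is where an unfolded side meets the ray to the tip. It is unique because
    admissibility puts the ends of that side strictly on opposite sides of the ray. *)
Lemma coded_inj s1 s2 c : admissible V v c -> coded s1 c -> coded s2 c -> s1 = s2.
Proof.
move=> ac [z1 f1 l1 h1] [z2 f2 l2 h2].
apply: (@eq_from_nth _ (0, 0)) => [|j]; first by rewrite z1 z2.
rewrite z1; case: j => [|j]; first by rewrite f1 f2.
rewrite !ltnS leq_eqVlt => /orP[/eqP ->|jc]; first by rewrite l1 l2.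
have [[t1 [_ e1]] x1] := h1 j jc; have [[t2 [_ e2]] x2] := h2 j jc.
rewrite e1 e2; congr (vadd _ (vscale _ _)).
have mc : (0 < j.+1 <= size c)%N by [].
have [] := ac.2 _ mc; rewrite /endr /endl !(take_nth ord0) //.
rewrite !last_rcons !size_rcons !unf_rcons.
move: x1 x2; rewrite e1 e2 -/(edge V _).
set i := nth ord0 c j; set u := take j c; set T := tip V v c.
have E t : unf V u (vadd (V i) (vscale t (edge V i))) =
           vadd (unf V u (V i)) (vscale t (unfl V u (edge V i))).
  have := vsub_unf area_gt0 u (vadd (V i) (vscale t (edge V i))) (V i).
  rewrite [X in unfl V u X](_ : _ = vscale t (edge V i)); last first.
    by rewrite /vsub /vadd /vscale /=; congr pair; ring.
  rewrite unfl_scale // => <-; rewrite [LHS]surjective_pairing.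
  by rewrite /vadd /vsub /=; congr pair; ring.
have En : unf V u (V (nextv i)) = vadd (unf V u (V i)) (unfl V u (edge V i)).
  rewrite /edge -vsub_unf // [LHS]surjective_pairing.
  by rewrite /vadd /vsub /=; congr pair; ring.
rewrite !E => x1 x2 hr hl; apply/eqP; rewrite -subr_eq0; apply/eqP.
have : (t1 - t2) * cross (unfl V u (edge V i)) T = 0.
  move: x1 x2; rewrite /cross /vsub /vadd /vscale /=; lra.
move/eqP; rewrite mulf_eq0 => /orP[/eqP //|/eqP k0]; exfalso; move: hr hl k0.
case: odd => /=; rewrite refl_start // refl_end // En;
  rewrite /cross /vsub /vadd /=; lra.
Qed.

Lemma gen_diag_coded s : gen_diag a b v s ->
  exists2 c, admissible V v c /\ size c = diag_length s & coded s c.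
Proof.
rewrite /gen_diag /diag_length; set k := (size s - 2)%N.
set q := nth (0, 0) s.
move=> [s2 q0 [w qw] inside law].
have sk : size s = k.+2 by rewrite -addn2 subnK.
have [i_ Hi] : {i_ : nat -> 'I_3 & forall j, (0 < j <= k)%N ->
    on_open_side a b (i_ j) (q j) /\
    reflection_law a b (i_ j) (q j.-1) (q j) (q j.+1)}.
  have /choice[f Hf] : forall j, exists i, (0 < j <= k)%N ->
    on_open_side a b i (q j) /\ reflection_law a b i (q j.-1) (q j) (q j.+1).
    by move=> j; case: (boolP (0 < j <= k)%N) => [/law[i h]|_]; [exists i | exists ord0].
  by exists f.
pose c := mkseq (fun j => i_ j.+1) k.
have sc : size c = k by rewrite size_mkseq.
have nc j : (j < k)%N -> nth ord0 c j = i_ j.+1 by move=> jk; rewrite nth_mkseq.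
have tc j : (j < k)%N -> take j.+1 c = rcons (take j c) (i_ j.+1).
  by move=> jk; rewrite (take_nth ord0) ?sc // nc.
have mid j i : (j <= k)%N ->
    0 < cross (edge V i) (vsub (q j) (V i)) + cross (edge V i) (vsub (q j.+1) (V i)).
  by move=> jk; apply: seg_inside_side; apply: inside.
(* Any two vertices lie on a common side, and then the midpoint is not inside. *)
have k0 : (0 < k)%N.
  rewrite lt0n; apply/eqP => k0; have := mid 0%N _ (leq0n k).
  have -> : q 1%N = V w by rewrite -qw k0.
  rewrite q0; case: (ord3_cases v w) => ->.
  - by move=> /(_ v); rewrite cross_edge_start addr0 ltxx.
  - by move=> /(_ v); rewrite cross_edge_start cross_edge_end addr0 ltxx.
  - move=> /(_ (nextv (nextv v))); rewrite cross_edge_start addr0.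
    by rewrite -{2}[v]nextv3 cross_edge_end ltxx.
have lc : last ord0 c = i_ k by rewrite -nth_last sc nc prednK.
have wE : w = nextv (nextv (last ord0 c)).
  have kk : (0 < k <= k)%N by rewrite k0 leqnn.
  have := mid k (i_ k) (leqnn k); have [onk _] := Hi k kk.
  rewrite qw (open_side_on_line onk) add0r lc.
  case: (ord3_cases (i_ k) w) => -> //; first by rewrite cross_edge_start ltxx.
  by rewrite cross_edge_end ltxx.
(* The unfolded directions of the segments. The reflection law cancels the reflection added at each
   crossing, so they are all positive multiples of the first: the unfolded orbit is straight. *)
pose D j := unfl V (take j c) (vsub (q j.+1) (q j)).
have HD j : (j <= k)%N -> exists2 t, 0 < t & D j = vscale t (D 0%N).
  elim: j => [_|j IH jk].
    by exists 1 => //; rewrite /vscale !mul1r -surjective_pairing.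
  have [t t0 Dj] := IH (ltnW jk).
  have [_ [t' [t'0 e]]] := Hi j.+1 jk.
  exists (t' * t); first exact: mulr_gt0.
  rewrite /D tc // unfl_rcons e /= -/(edge V _).
  set u := edge V _; set d := vsub _ _.
  have -> : Defs.reflect u (vscale t' (Defs.reflect u d)) = vscale t' d.
    rewrite -[in RHS](@reflect_involutive R V area_gt0 (i_ j.+1) d) -/u.
    exact: (unfl_scale V [:: i_ j.+1]).
  rewrite unfl_scale -/(D j) Dj.
  by rewrite /vscale /= !mulrA.
pose X j := unf V (take j c) (q j).
have XS j : (j < k)%N -> X j.+1 = unf V (take j c) (q j.+1).
  move=> jk; rewrite /X tc // unf_rcons refl_open_side //.
  by have [] := Hi j.+1 jk.
have XD j : (j < k)%N -> X j.+1 = vadd (X j) (D j).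
  move=> jk; rewrite /D -vsub_unf // XS // [LHS]surjective_pairing.
  by rewrite /vadd /vsub /=; congr pair; ring.
have vadd_scale t t' (x : pt) : vadd (vscale t x) (vscale t' x) = vscale (t + t') x.
  by rewrite /vadd /vscale /=; congr pair; ring.
have vsub_vadd (x y z : pt) : vsub (vadd x y) z = vadd (vsub x z) y.
  by rewrite /vadd /vsub /=; congr pair; ring.
have HX j : (j <= k)%N -> exists2 t, 0 <= t & vsub (X j) (V v) = vscale t (D 0%N).
  elim: j => [_|j IH jk].
    exists 0 => //; rewrite /X take0 /= q0.
    by rewrite /vsub /vscale !subrr !mul0r.
  have [t t0 Xj] := IH (ltnW jk); have [t' t'0 Dj] := HD j (ltnW jk).
  exists (t + t'); first by rewrite addr_ge0 // ltW.
  by rewrite XD // vsub_vadd Xj Dj vadd_scale.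
have [T T0 HT] : exists2 T, 0 < T & tip V v c = vscale T (D 0%N).
  have [t t0 Xk] := HX k (leqnn k); have [t' t'0 Dk] := HD k (leqnn k).
  exists (t + t'); first by rewrite ltr_wpDl.
  rewrite -vadd_scale -Xk -Dk -vsub_vadd /tip; congr (vsub _ _).
  rewrite -wE -qw /D -vsub_unf // /X take_oversize ?sc //.
  by rewrite [LHS]surjective_pairing /vadd /vsub /=; congr pair; ring.
(* The orbit leaves the triangle through side [i_ j.+1], so its direction points outward there; the
   sign records the orientation of the copy. *)
have neg j : (j < k)%N ->
    cross (unfl V (take j c) (edge V (i_ j.+1))) (D 0%N) * (-1) ^+ j < 0.
  move=> jk; have [t t0 Dj] := HD j (ltnW jk).
  have [on _] := Hi j.+1 jk.
  have h := mid j (i_ j.+1) (ltnW jk).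
  rewrite (open_side_on_line on) addr0 in h.
  have h' : cross (edge V (i_ j.+1)) (vsub (q j.+1) (q j)) < 0.
    by move: h (open_side_on_line on); rewrite /cross /vsub /=; lra.
  rewrite -(pmulr_rlt0 _ t0).
  have -> : forall y z w : R, y * (z * w) = (y * z) * w by move=> *; ring.
  have -> : t * cross (unfl V (take j c) (edge V (i_ j.+1))) (D 0%N) =
     cross (unfl V (take j c) (edge V (i_ j.+1))) (D j).
    by rewrite Dj /cross /vscale /=; ring.
  rewrite /D cross_unfl // size_take sc jk mulrAC -exprMn mulrNN mulr1 expr1n.
  by rewrite mul1r.
exists c; last first.
  split; rewrite ?sc //; first by rewrite -wE.
  move=> j jk; rewrite nc // -/(q _) -XS //; split; first by have [] := Hi j.+1 jk.
  have [t _ ->] := HX j.+1 jk.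
  by rewrite HT /cross /vscale /=; ring.
split=> //; split; first by rewrite -size_eq0 sc -lt0n.
case=> // j; rewrite sc /= => jk.
have [t t0 Xj] := HX j.+1 jk.
have [[r [/andP[s0 s1] es]] _] := Hi j.+1 jk.
have E1 : unf V (take j c) (V (i_ j.+1)) =
    vsub (X j.+1) (vscale r (unfl V (take j c) (edge V (i_ j.+1)))).
  rewrite XS // -unfl_scale [LHS](_ : _ = vsub (unf V (take j c) (q j.+1))
    (vsub (unf V (take j c) (q j.+1)) (unf V (take j c) (V (i_ j.+1))))).
    rewrite vsub_unf // es -/(edge V _); congr (vsub _ (unfl _ _ _)).
    by rewrite /vsub /vadd /vscale /=; congr pair; ring.
  by rewrite [LHS]surjective_pairing /vsub /=; congr pair; ring.
have E2 : unf V (take j c) (V (nextv (i_ j.+1))) =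
    vadd (unf V (take j c) (V (i_ j.+1))) (unfl V (take j c) (edge V (i_ j.+1))).
  rewrite /edge -vsub_unf // [LHS]surjective_pairing.
  by rewrite /vadd /vsub /=; congr pair; ring.
rewrite /endr /endl tc // last_rcons size_rcons !unf_rcons.
have e2 : unf V (take j c) (V (nextv (i_ j.+1))) =
    vadd (X j.+1) (vscale (1 - r) (unfl V (take j c) (edge V (i_ j.+1)))).
  by rewrite E2 E1 /vadd /vsub /vscale /=; congr pair; ring.
move: (neg j jk); rewrite -signr_odd size_take sc jk /=.
set e := unfl V (take j c) _ in E1 e2 *; rewrite HT => negj.
(* The reflection point divides the side in the ratio r : 1 - r with 0 < r < 1, so the two ends fall
   strictly on opposite sides of the ray. *)
have x1 : cross (vsub (unf V (take j c) (V (i_ j.+1))) (V v)) (vscale T (D 0%N)) =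
   - (r * T) * cross e (D 0%N).
  rewrite E1 [vsub (vsub _ _) _](_ : _ = vsub (vsub (X j.+1) (V v)) (vscale r e)).
    by rewrite Xj /cross /vsub /vscale /=; ring.
  by rewrite /vsub /=; congr pair; ring.
have x2 : cross (vsub (unf V (take j c) (V (nextv (i_ j.+1)))) (V v)) (vscale T (D 0%N)) =
   (1 - r) * T * cross e (D 0%N).
  rewrite e2 vsub_vadd Xj /cross /vadd /vscale /=; ring.
have sT : 0 < r * T by rewrite mulr_gt0.
have s1T : 0 < (1 - r) * T by rewrite mulr_gt0 // subr_gt0.
move: negj; case: odd => /=; rewrite refl_start // refl_end // => negj.
  have k1 : 0 < cross e (D 0%N) by move: negj; rewrite expr1; lra.
  rewrite x2 (crossC (vscale _ _)) x1 mulNr opprK; split; exact: mulr_gt0.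
have k1 : cross e (D 0%N) < 0 by move: negj; rewrite expr0; lra.
by rewrite x1 (crossC (vscale _ _)) x2 mulNr !oppr_gt0 !pmulr_rlt0.
Qed.

End GeneralizedDiagonals.

(** * Sublevel sets of integer polynomials *)

Section RootBound.
Variable R : rcfType.
Local Open Scope complex_scope.

(** The polynomial splits over the complex numbers, and for real [t] replacing a root by its real
    part only decreases the distance. *)
Lemma norm_lead_coef_prod_le (p : {poly R}) : exists2 xs : seq R,
  size xs = (size p).-1 &
  forall t, `|lead_coef p| * \prod_(x <- xs) `|t - x| <= `|p.[t]|.
Proof.
have [zs] := closed_field_poly_normal (map_poly (real_complex R) p).
set p' := map_poly _ p => ep.
have [p0|p0] := eqVneq p 0.
  exists [::]; first by rewrite p0 size_poly0.
  by move=> t; rewrite p0 lead_coef0 normr0 mul0r.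
have lp0 : lead_coef p' != 0.
  by rewrite lead_coef_eq0 map_poly_eq0.
exists (map (@complex.Re R) zs).
  rewrite size_map -(size_map_poly (real_complex R)) -/p' ep.
  by rewrite size_scale // size_prod_XsubC.
move=> t; rewrite -lecR; have -> : (`|p.[t]|)%:C = `|p'.[t%:C]|.
  by rewrite /p' horner_map /= normc_def /= expr0n addr0 sqrtr_sqr.
rewrite ep hornerZ normrM horner_prod normr_prod.
have -> : (`|lead_coef p| * \prod_(x <- map (@complex.Re R) zs) `|t - x|)%:C =
   `|lead_coef p'| * \prod_(z <- zs) (`|t - complex.Re z|)%:C.
  rewrite rmorphM rmorph_prod big_map /=; congr (_ * _).
  by rewrite /p' lead_coef_map normc_def /= expr0n addr0 sqrtr_sqr.
rewrite ler_wpM2l // ler_prod // => z _.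
rewrite hornerXsubC; apply/andP; split; first by rewrite lecR.
have -> : t - complex.Re z = complex.Re (t%:C - z) by case: z.
exact: normc_ge_Re.
Qed.
End RootBound.

Section IntegerPolynomials.
Variable R : realType.
Implicit Types (p q : R) (f g : R -> R -> R).

Definition evalx p : {poly int} -> R := horner_eval p \o map_poly intr.
HB.instance Definition _ p := GRing.RMorphism.on (evalx p).

Lemma evalxE p c : evalx p c = (map_poly intr c).[p].
Proof. by []. Qed.

Definition eval2 (P : {poly {poly int}}) p q : R :=
  (map_poly (evalx p) P).[q].

Definition bidegree_le d (P : {poly {poly int}}) :=
  (size P <= d.+1)%N /\ forall i, (size (P`_i)%R <= d.+1)%N.

Definition int_poly d f := exists P,
  bidegree_le d P /\ forall p q, f p q = eval2 P p q.

Lemma int_poly_ext d f g : (forall p q, f p q = g p q) -> int_poly d f -> int_poly d g.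
Proof. by move=> fg [P [dP fP]]; exists P; split=> // p q; rewrite -fg. Qed.

Lemma int_poly_leq d d' f : (d <= d')%N -> int_poly d f -> int_poly d' f.
Proof.
move=> dd' [P [[s1 s2] fP]]; exists P; split=> //.
by split=> [|i]; [apply: leq_trans s1 _ | apply: leq_trans (s2 i) _].
Qed.

Lemma int_poly_nat n : int_poly 0 (fun _ _ => n%:R).
Proof.
exists (n%:R); split; last by move=> p q; rewrite /eval2 rmorph_nat -(rmorph_nat polyC) hornerC.
rewrite -(rmorph_nat polyC); split; first exact: size_polyC_leq1.
move=> i; rewrite coefC; case: ifP => _; last by rewrite size_poly0.
by rewrite -(rmorph_nat polyC) size_polyC_leq1.
Qed.

Lemma int_poly_x : int_poly 1 (fun p _ => p).
Proof.
exists ('X%:P); split; last first.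
  move=> p q; transitivity ((map_poly intr 'X : {poly R}).[p]).
    by rewrite map_polyX hornerX.
  by rewrite /eval2 map_polyC hornerC.
split; first exact: leq_trans (size_polyC_leq1 _) _.
by move=> i; rewrite coefC; case: ifP => _; rewrite ?size_polyX ?size_poly0.
Qed.

Lemma int_poly_y : int_poly 1 (fun _ q => q).
Proof.
exists 'X; split; last by move=> p q; rewrite /eval2 map_polyX hornerX.
split; first by rewrite size_polyX.
by move=> i; rewrite coefX; case: (i == 1%N); rewrite ?size_poly1 ?size_poly0.
Qed.

Lemma int_poly_opp d f : int_poly d f -> int_poly d (fun p q => - f p q).
Proof.
move=> [P [[s1 s2] fP]]; exists (- P); split.
  by split; [rewrite size_polyN | move=> i; rewrite coefN size_polyN].
by move=> p q; rewrite fP /eval2 rmorphN /= hornerN.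
Qed.

Lemma int_poly_add d f g : int_poly d f -> int_poly d g ->
  int_poly d (fun p q => f p q + g p q).
Proof.
move=> [P [[s1 s2] fP]] [Q [[t1 t2] gQ]]; exists (P + Q); split.
  split=> [|i]; rewrite ?coefD.
    by rewrite (leq_trans (size_polyD _ _)) // geq_max s1.
  by rewrite (leq_trans (size_polyD _ _)) // geq_max s2 t2.
by move=> p q; rewrite fP gQ /eval2 rmorphD /= hornerD.
Qed.

Lemma int_poly_sub d f g : int_poly d f -> int_poly d g ->
  int_poly d (fun p q => f p q - g p q).
Proof. by move=> hf hg; apply: int_poly_add hf (int_poly_opp hg). Qed.

Lemma int_poly_mul d e f g : int_poly d f -> int_poly e g ->
  int_poly (d + e) (fun p q => f p q * g p q).
Proof.
move=> [P [[s1 s2] fP]] [Q [[t1 t2] gQ]]; exists (P * Q); split.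
  have mul_size (A : nzRingType) (x y : {poly A}) : (size x <= d.+1)%N ->
      (size y <= e.+1)%N -> (size (x * y)%R <= (d + e).+1)%N.
    by move=> hx hy; rewrite (leq_trans (size_polyMleq _ _)) //; lia.
  split=> [|i]; first exact: mul_size.
  rewrite coefM (leq_trans (size_sum _ _ _)) //.
  by apply/bigmax_leqP => j _; apply: mul_size.
by move=> p q; rewrite fP gQ /eval2 rmorphM /= hornerM.
Qed.

Lemma int_poly_exp d f n : int_poly d f -> int_poly (n * d) (fun p q => f p q ^+ n).
Proof.
move=> hf; elim: n => [|n IH].
  by apply: int_poly_ext (int_poly_nat 1) => p q; rewrite expr0.
by apply: int_poly_ext (int_poly_mul hf IH) => p q; rewrite exprS.
Qed.

(* For [P != 0] the leading coefficient in [q] is a nonzero integer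
   polynomial in [p], itself with leading coefficient at least 1 in absolute
   value. *)
Lemma sublevel_near_roots d (P : {poly {poly int}}) : P != 0 -> bidegree_le d P ->
  exists (xs : seq R) (ys : R -> seq R),
  [/\ (size xs <= d)%N, forall p, (size (ys p) <= d)%N &
   forall p q t, 0 < t <= 1 -> `|eval2 P p q| < t ^+ (d + d) ->
     (exists2 x, x \in xs & `|p - x| < t) \/
     (exists2 y, y \in ys p & `|q - y| < t)].
Proof.
move=> P0 [s1 s2]; set c := lead_coef P.
have c0 : c != 0 by rewrite lead_coef_eq0.
have [xs sxs Hxs] := norm_lead_coef_prod_le (map_poly intr c : {poly R}).
have Hys p := norm_lead_coef_prod_le (map_poly (evalx p) P).
pose ys p := s2val (cid2 (Hys p)).
have inj0 : map_poly intr c != 0 :> {poly R}.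
  by rewrite map_poly_eq0_id0 // intr_eq0 lead_coef_eq0.
have szc : size (map_poly intr c : {poly R}) = size c.
  by rewrite size_map_poly_id0 // intr_eq0 lead_coef_eq0.
have sc : (size c <= d.+1)%N by apply: s2.
have pow_le (t : R) (s : seq R) (z : R) : 0 < t <= 1 -> (size s <= d)%N ->
   (forall x, x \in s -> t <= `|z - x|) -> t ^+ d <= \prod_(x <- s) `|z - x|.
  move=> /andP[t0 t1] sd h.
  apply: le_trans (_ : t ^+ size s <= _).
    by apply: ler_wiXn2l => //; exact: ltW.
  elim: s h {sd} => [|x s IH] h; first by rewrite big_nil expr0.
  rewrite big_cons exprS ler_pM ?exprn_ge0 ?(ltW t0) //.
    by apply: h; rewrite mem_head.
  by apply: IH => y ys'; apply: h; rewrite inE ys' orbT.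
exists xs, ys; split.
- by rewrite sxs szc; case: (size c) sc.
- move=> p; rewrite (s2valP (cid2 (Hys p))).
  have := leq_trans (size_poly _ _ : size (map_poly (evalx p) P) <= size P)%N s1.
  by case: (size _).
move=> p q t t01 small; case: (boolP (has (fun x => `|p - x| < t) xs)).
  by move=> /hasP[x xin xt]; left; exists x.
move=> /hasPn far; right.
have cp : t ^+ d <= `|evalx p c|.
  apply: le_trans (Hxs p).
  apply: le_trans (_ : 1 * \prod_(x <- xs) `|p - x| <= _).
    rewrite mul1r; apply: pow_le => //; first by rewrite sxs szc; case: (size c) sc.
    by move=> x /far; rewrite -leNgt.
  rewrite ler_wpM2r ?prodr_ge0 // lead_coef_map_inj //; last exact: intr_inj.
  by rewrite -intr_norm ler1z -gtz0_ge1 normr_gt0 lead_coef_eq0.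
case: (boolP (has (fun y => `|q - y| < t) (ys p))).
  by move=> /hasP[y yin yt]; exists y.
move=> /hasPn far'; exfalso; move: small; apply/negP; rewrite -leNgt.
have [t0 _] := andP t01.
have cp0 : evalx p c != 0.
  by rewrite -normr_gt0; apply: lt_le_trans cp; apply: exprn_gt0.
have := s2valP' (cid2 (Hys p)) q; rewrite -/(ys p) => Hq.
apply: le_trans Hq; rewrite exprD ler_pM ?exprn_ge0 ?(ltW t0) //.
  by rewrite lead_coef_map_eq.
apply: pow_le => //; last by move=> y /far'; rewrite -leNgt.
rewrite (s2valP (cid2 (Hys p))).
have := leq_trans (size_poly _ _ : size (map_poly (evalx p) P) <= size P)%N s1.
by case: (size _).
Qed.

End IntegerPolynomials.

(** * Measure of sublevel sets in the angles *)

Section SublevelMeasure.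
Variable R : realType.
Local Notation mu := (@lebesgue_measure R).
Local Notation mu2 := (mu \x mu)%E.

Definition cotg (a : R) := cos a / sin a.

(** Angles are recovered from cotangents by [pi / 2 - atan], so a neighbourhood of a root in the
    cotangent is no wider in the angle. *)
Lemma atan_lipschitz (x y : R) : `|atan x - atan y| <= `|x - y|.
Proof.
wlog xy : x y / x < y.
  move=> wl; have [/wl //|/wl|->] := ltgtP x y; last by rewrite !subrr.
  by rewrite distrC (distrC x).
have [c _] : exists2 c, c \in `]x, y[%R & atan y - atan x = (1 + c ^+ 2)^-1 * (y - x).
  by apply: MVT => //; apply/continuous_subspaceT => z; apply: continuous_atan.
rewrite distrC (distrC x) => ->; rewrite normrM ler_piMl //.
rewrite ger0_norm ?invr_ge0 ?addr_ge0 ?sqr_ge0 //.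
by rewrite invf_le1 ?lerDl ?sqr_ge0 // ltr_wpDr ?sqr_ge0.
Qed.

Lemma atan_cotg a : 0 < a < pi -> pi / 2 - atan (cotg a) = a.
Proof.
move=> /andP[a0 api].
have -> : cotg a = tan (pi / 2 - a).
  by rewrite /cotg /tan sinB cosB sin_pihalf cos_pihalf !mul0r !mul1r subr0 add0r.
rewrite tanK ?subKr // in_itv /=; apply/andP; split; lra.
Qed.

Definition disk (x t : R) : set R := [set y | `|x - y| < t].

Lemma measurable_disk x t : measurable (disk x t).
Proof. exact: measurable_ball. Qed.

Lemma measure_disk x t : 0 < t -> mu (disk x t) = (t *+ 2)%:E.
Proof. by move=> t0; apply: (lebesgue_measure_ball x (ltW t0)). Qed.

Lemma cotg_near (x t a : R) : 0 < a < pi -> `|cotg a - x| < t ->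
  disk (pi / 2 - atan x) t a.
Proof.
move=> a0 h; rewrite /disk /= -(atan_cotg a0).
have -> : pi / 2 - atan x - (pi / 2 - atan (cotg a)) = atan (cotg a) - atan x.
  by ring.
exact: le_lt_trans (atan_lipschitz _ _) h.
Qed.

Lemma measurable_cotg : measurable_fun (`]0, pi[ : set R) cotg.
Proof.
apply: open_continuous_measurable_fun; first exact: interval_open.
move=> a; rewrite inE /= in_itv /= => a0.
apply: (@continuousM _ _ (@cos R) (fun x => (sin x)^-1)); first exact: continuous_cos.
apply: continuousV; last exact: continuous_sin.
by rewrite gt_eqF // sin_gt0_pi.
Qed.

Lemma measure_balls_le (xs : seq R) (f : R -> R) (t : R) : 0 < t ->
  measurable (\big[setU/set0]_(x <- xs) disk (f x) t) /\
  (mu (\big[setU/set0]_(x <- xs) disk (f x) t) <= ((size xs)%:R * (t *+ 2))%:E)%E.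
Proof.
move=> t0; elim: xs => [|x xs [mB IH]]; first by rewrite big_nil measure0 mul0r.
rewrite big_cons; have mb := measurable_disk (f x) t.
split; first exact: measurableU.
apply: (@le_trans _ _ (mu (disk (f x) t) +
    mu (\big[setU/set0]_(y <- xs) disk (f y) t))%E).
  exact: (measureU2 mu mb mB).
rewrite measure_disk //= [X in (_ <= X)%E](_ : _ =
  (t *+ 2)%:E + ((size xs)%:R * (t *+ 2))%:E)%E; first exact: leeD2l.
by rewrite -EFinD -natr1; congr EFin; ring.
Qed.

Lemma measurable_horner d (T : measurableType d) (D : set T) (c : nat -> T -> R)
    (g : T -> R) n :
  (forall i, measurable_fun D (c i)) -> measurable_fun D g ->
  measurable_fun D (fun z => \sum_(i < n) c i z * g z ^+ i).
Proof.
move=> mc mg; apply: measurable_sum => i.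
by apply: measurable_funM => //; apply: measurable_funX.
Qed.

Definition square : set (R * R) := `]0, pi[ `*` `]0, pi[.

Lemma measurable_square : measurable square.
Proof. exact: measurableX. Qed.

Lemma measurable_evalx c : measurable_fun square (fun z => evalx (cotg z.1) c).
Proof.
have -> : (fun z : R * R => evalx (cotg z.1) c) =
   (fun z => \sum_(i < size c) (c`_i)%:~R * cotg z.1 ^+ i).
  apply/funext => z; rewrite evalxE (horner_coef_wide _ (size_poly _ _)).
  by apply: eq_bigr => i _; rewrite coef_map.
apply: (measurable_horner (c := fun i _ => (c`_i)%:~R)) => [i|].
  exact: measurable_cst.
apply: (measurable_comp (F := `]0, pi[)) => //.
- by move=> _ [z [z1 _]] <-.
- exact: measurable_cotg.
- by apply: measurable_funS measurable_fst.
Qed.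

Lemma measurable_eval2 P : measurable_fun square (fun z => eval2 P (cotg z.1) (cotg z.2)).
Proof.
have -> : (fun z : R * R => eval2 P (cotg z.1) (cotg z.2)) =
   (fun z => \sum_(i < size P) evalx (cotg z.1) P`_i * cotg z.2 ^+ i).
  apply/funext => z; rewrite /eval2 (horner_coef_wide _ (size_poly _ _)).
  by apply: eq_bigr => i _; rewrite coef_map.
apply: (measurable_horner (c := fun i z => evalx (cotg z.1) P`_i)) => [i|].
  exact: measurable_evalx.
apply: (measurable_comp (F := `]0, pi[)) => //.
- by move=> _ [z [_ z2]] <-.
- exact: measurable_cotg.
- by apply: measurable_funS measurable_snd.
Qed.

Definition sublevel (P : {poly {poly int}}) (e : R) : set (R * R) :=
  square `&` [set z | `|eval2 P (cotg z.1) (cotg z.2)| < e].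

Lemma measurable_sublevel P e : measurable (sublevel P e).
Proof.
have := measurable_eval2 P => /(_ measurable_square _ (measurable_disk 0 e)).
congr measurable; rewrite /sublevel; congr (_ `&` _).
by apply/seteqP; split=> z /=; rewrite /disk /= sub0r normrN.
Qed.

Lemma measure_0pi : mu (`]0, pi[ : set R) = (pi : R)%:E.
Proof. by rewrite lebesgue_measure_itv /= lte_fin pi_gt0 oppr0 adde0. Qed.

(** The strip [A1] collects the first angles near a root of the leading coefficient. Outside it,
    each section at a fixed first angle lies in at most [d] intervals of length 2t. Each part has
    measure at most 2 pi d t. *)
Lemma sublevel_measure d (P : {poly {poly int}}) (t : R) :
  P != 0 -> bidegree_le d P -> 0 < t <= 1 ->
  (mu2 (sublevel P (t ^+ (d + d))) <= (4 * pi * d%:R * t)%:E)%E.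
Proof.
move=> P0 dP t01; have [t0 t1] := andP t01.
have [xs [ys [sxs sys near]]] := sublevel_near_roots R P0 dP.
pose U (zs : seq R) := \big[setU/set0]_(z <- zs) disk (pi / 2 - atan z) t.
have inU zs z a : z \in zs -> 0 < a < pi -> `|cotg a - z| < t -> U zs a.
  move=> zin a0 h; rewrite /U -bigcup_seq /=; exists z => //; exact: cotg_near.
have mU zs : measurable (U zs).
  exact: (measure_balls_le zs (fun z => pi / 2 - atan z) t0).1.
have Ule zs : (size zs <= d)%N -> (mu (U zs) <= (d%:R * (t *+ 2))%:E)%E.
  move=> sd; apply: le_trans (measure_balls_le zs (fun z => pi / 2 - atan z) t0).2 _.
  by rewrite lee_fin ler_wpM2r ?ler_nat // mulrn_wge0 // ltW.
pose S := sublevel P (t ^+ (d + d)).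
pose A1 : set (R * R) := U xs `*` `]0, pi[.
have mA1 : measurable A1 by exact: measurableX.
have mS : measurable S by exact: measurable_sublevel.
have mA2 : measurable (S `\` A1) by exact: measurableD.
have S12 : S `<=` A1 `|` (S `\` A1).
  by move=> z Sz; case: (pselect (A1 z)) => h; [left | right].
have pi0 : 0 <= (pi : R) := pi_ge0 R.
have dt0 : 0 <= d%:R * (t *+ 2) by rewrite mulr_ge0 // mulrn_wge0 // ltW.
have le1 : (mu2 A1 <= (d%:R * (t *+ 2) * pi)%:E)%E.
  have -> : mu2 A1 = (mu (U xs) * mu (`]0%R, pi[ : set R))%E.
    have := @product_measure1E _ _ _ _ R mu mu (U xs) (`]0, pi[%classic : set R) (mU xs).
    by apply; apply: measurable_itv.
  rewrite [X in (_ * X)%E]measure_0pi EFinM.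
  by rewrite lee_wpmul2r ?lee_fin // Ule.
have le2 : (mu2 (S `\` A1) <= (d%:R * (t *+ 2) * pi)%:E)%E.
  have -> : (d%:R * (t *+ 2) * pi)%:E = (\int[mu]_x (cst (d%:R * (t *+ 2))%:E \_ `]0%R, pi[) x)%E.
    rewrite -integral_mkcond integral_cst //.
    by rewrite [X in (_ * X)%E]measure_0pi EFinM.
  apply: ge0_le_integral => //.
  - exact: measurable_fun_xsection.
  - exact/measurable_restrict.
  move=> x _; rewrite /patch /=; case: ifPn => [|xn].
    rewrite inE /= in_itv /= => x0.
    apply: le_trans (Ule (ys (cotg x)) (sys _)).
    apply: le_measure; [by apply/mem_set; exact: measurable_xsection | by apply/mem_set; apply: mU|].
    move=> y /set_mem[[[_ /=]]]; rewrite in_itv /= => y0 h nA1.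
    case: (near _ _ _ t01 h) => [[z zin zx]|[z zin zy]]; last exact: inU zin y0 zy.
    exfalso; apply: nA1; split=> /=; last by rewrite in_itv.
    exact: inU zin x0 zx.
  rewrite [X in mu X](_ : _ = set0) ?measure0 //.
  apply/seteqP; split=> // y /set_mem[[[/= x0 _] _] _].
  by move: xn; rewrite notin_setE; apply.
apply: (@le_trans _ _ (mu2 A1 + mu2 (S `\` A1))%E).
  apply: le_trans (measureU2 mu2 mA1 mA2).
  by apply: le_measure => //; rewrite ?inE; try exact: measurableU.
apply: le_trans (leeD le1 le2) _.
by rewrite -EFinD lee_fin [X in X <= _](_ : _ = 4 * pi * d%:R * t) //; ring.
Qed.

End SublevelMeasure.

(** * Unfolded vertices as polynomials in the cotangents *)

Section PolynomialPositions.
Variable R : realType.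
Notation pt := (R * R)%type.
Implicit Types (p q : R).

(* The triangle whose base angles have cotangents [p] and [q]. *)
Definition cot_vtx p q (i : 'I_3) : pt :=
  if val i == 0%N then (0, 0)
  else if val i == 1%N then (1, 0) else (p / (p + q), (p + q)^-1).

Lemma vtx_cot (a b : R) : 0 < a -> 0 < b -> a + b < pi ->
  cotg a + cotg b != 0 /\ vtx a b =1 cot_vtx (cotg a) (cotg b).
Proof.
move=> a0 b0 ab; have sa := sin_a_gt0 a0 b0 ab; have sb := sin_b_gt0 a0 b0 ab.
have sab := sin_ab_gt0 a0 b0 ab.
have e : cotg a + cotg b = sin (a + b) / (sin a * sin b).
  by rewrite sinD /cotg; field; rewrite !gt_eqF.
split; first by rewrite e gt_eqF // divr_gt0 // mulr_gt0.
move=> i; rewrite /vtx /cot_vtx; case: ifP => // _; case: ifP => // _.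
rewrite e /cotg; congr pair; first by field; rewrite !gt_eqF.
by field; rewrite !gt_eqF.
Qed.

Lemma reflect_scale (t : R) (u d : pt) : t != 0 -> dot u u != 0 ->
  Defs.reflect (vscale t u) d = Defs.reflect u d.
Proof.
move=> t0 u0; rewrite /Defs.reflect.
have -> : dot d (vscale t u) = t * dot d u by rewrite /dot /=; ring.
have -> : dot (vscale t u) (vscale t u) = t ^+ 2 * dot u u by rewrite /dot /=; ring.
by rewrite /vsub /vscale /=; congr pair; field; rewrite t0 u0.
Qed.

(** After rescaling, the sides at the apex have directions (-q, 1) and (-p, -1), so p + q drops out
    and a reflection brings only the denominator 1 + q^2 or 1 + p^2. *)
Lemma refl_cot p q (i : 'I_3) (x : pt) : p + q != 0 ->
  refl (cot_vtx p q) i x =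
  if val i == 0%N then (x.1, - x.2) else
  if val i == 1%N then
    (1 + ((q ^+ 2 - 1) * (x.1 - 1) - 2 * q * x.2) / (1 + q ^+ 2),
     (- 2 * q * (x.1 - 1) + (1 - q ^+ 2) * x.2) / (1 + q ^+ 2))
  else (((p ^+ 2 - 1) * x.1 + 2 * p * x.2) / (1 + p ^+ 2),
        (2 * p * x.1 + (1 - p ^+ 2) * x.2) / (1 + p ^+ 2)).
Proof.
move=> s0.
have sq (t : R) : 1 + t ^+ 2 != 0 by rewrite gt_eqF // ltr_pwDl // sqr_ge0.
case: i => -[|[|[|//]]] Hi /=.
- rewrite /refl (_ : edge _ _ = (1, 0)); last by rewrite /edge /vsub /cot_vtx /= !subr0.
  by rewrite /Defs.reflect /vadd /vsub /vscale /dot /cot_vtx /=; congr pair; field.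
- rewrite /refl (_ : edge _ _ = vscale (p + q)^-1 (- q, 1)); last first.
    by rewrite /edge /vsub /vscale /cot_vtx /=; congr pair; field.
  rewrite reflect_scale ?invr_eq0 //; last by rewrite /dot /= mulrNN addrC mulr1 -expr2.
  rewrite /Defs.reflect /vadd /vsub /vscale /dot /cot_vtx /=.
  by congr pair; field; rewrite ?sq // mulrNN addrC mulr1 -expr2.
- rewrite /refl (_ : edge _ _ = vscale (p + q)^-1 (- p, - 1)); last first.
    by rewrite /edge /vsub /vscale /cot_vtx /=; congr pair; field.
  rewrite reflect_scale ?invr_eq0 //; last by rewrite /dot /= !mulrNN addrC mulr1 -expr2.
  rewrite /Defs.reflect /vadd /vsub /vscale /dot /cot_vtx /=.
  by congr pair; field; rewrite ?sq //=.
Qed.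

Definition cot_den p q : R := (1 + p ^+ 2) * (1 + q ^+ 2).

Lemma int_poly_den : int_poly 4 cot_den.
Proof.
apply: (int_poly_mul (d := 2) (e := 2)).
  apply: int_poly_add; first exact: int_poly_leq (int_poly_nat R 1).
  exact: (int_poly_exp 2 (int_poly_x R)).
apply: int_poly_add; first exact: int_poly_leq (int_poly_nat R 1).
exact: (int_poly_exp 2 (int_poly_y R)).
Qed.

Lemma int_poly_addc : int_poly 1 (fun p q : R => p + q).
Proof. exact: int_poly_add (int_poly_x R) (int_poly_y R). Qed.

(** The factor p + q clears the denominator of the apex, and each of the [h] reflections costs one
    [cot_den], counted with degree 4; hence 4h + 1. *)
Definition rational_point h (x : R -> R -> pt) := exists X Y,
  [/\ int_poly (4 * h + 1) X, int_poly (4 * h + 1) Y &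
  forall p q, p + q != 0 ->
    (p + q) * cot_den p q ^+ h * (x p q).1 = X p q /\
    (p + q) * cot_den p q ^+ h * (x p q).2 = Y p q].

Lemma rational_vtx i : rational_point 0 (fun p q => cot_vtx p q i).
Proof.
have i0 n : int_poly 1 (fun _ _ : R => n%:R) := int_poly_leq (leq0n 1) (int_poly_nat R n).
case: i => -[|[|[|//]]] Hi; rewrite /rational_point /cot_vtx /=.
- exists (fun _ _ => 0%:R), (fun _ _ => 0%:R); split=> // p q _.
  by rewrite !mulr0.
- exists (fun p q => p + q), (fun _ _ => 0%:R); split=> //.
    exact: int_poly_addc.
  by move=> p q _; rewrite !mulr0 !mulr1.
- exists (fun p _ => p), (fun _ _ => 1%:R); split=> //; first exact: int_poly_x.
  by move=> p q s0; split; rewrite expr0; field.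
Qed.

Lemma rational_point_lift h h' x : (h <= h')%N -> rational_point h x ->
  rational_point h' x.
Proof.
move=> hh [X [Y [hX hY E]]].
have hD := int_poly_exp (h' - h) int_poly_den.
have deg : (((h' - h) * 4) + (4 * h + 1) <= 4 * h' + 1)%N by lia.
exists (fun p q => cot_den p q ^+ (h' - h) * X p q), (fun p q => cot_den p q ^+ (h' - h) * Y p q).
split; [exact: int_poly_leq deg (int_poly_mul hD hX) | exact: int_poly_leq deg (int_poly_mul hD hY) |].
move=> p q s0; have [<- <-] := E p q s0.
by split; rewrite -{1}(subnK hh) exprD; ring.
Qed.

Lemma rational_refl h i x : rational_point h x ->
  rational_point h.+1 (fun p q => refl (cot_vtx p q) i (x p q)).
Proof.
move=> [X [Y [hX hY E]]].
have ip0 n d : int_poly d (fun _ _ : R => n%:R) := int_poly_leq (leq0n d) (int_poly_nat R n).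
have p2 : int_poly 2 (fun p _ : R => p ^+ 2) := int_poly_exp 2 (int_poly_x R).
have q2 : int_poly 2 (fun _ q : R => q ^+ 2) := int_poly_exp 2 (int_poly_y R).
have pD := int_poly_add (ip0 1%N 2) p2; have qD := int_poly_add (ip0 1%N 2) q2.
have pB := int_poly_sub p2 (ip0 1%N 2); have qB := int_poly_sub q2 (ip0 1%N 2).
have pB' := int_poly_sub (ip0 1%N 2) p2; have qB' := int_poly_sub (ip0 1%N 2) q2.
have p1 : int_poly 2 (fun p _ : R => 2%:R * p).
  exact: int_poly_leq (int_poly_mul (ip0 2%N 0) (int_poly_x R)).
have q1 : int_poly 2 (fun _ q : R => 2%:R * q).
  exact: int_poly_leq (int_poly_mul (ip0 2%N 0) (int_poly_y R)).
have sD : int_poly (4 * h + 1) (fun p q : R => (p + q) * cot_den p q ^+ h).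
  have := int_poly_mul int_poly_addc (int_poly_exp h int_poly_den).
  by apply: int_poly_leq; lia.
have deg : (4 + (4 * h + 1) <= 4 * h.+1 + 1)%N by lia.
have deg' : (2 + (2 + (4 * h + 1)) <= 4 * h.+1 + 1)%N by lia.
have sq (t : R) : 1 + t ^+ 2 != 0 by rewrite gt_eqF // ltr_pwDl // sqr_ge0.
case: i => -[|[|[|//]]] Hi.
- exists (fun p q => cot_den p q * X p q), (fun p q => - (cot_den p q * Y p q)).
  split; first exact: int_poly_leq deg (int_poly_mul int_poly_den hX).
    exact/int_poly_opp/(int_poly_leq deg)/(int_poly_mul int_poly_den hY).
  by move=> p q s0; have [<- <-] := E p q s0; rewrite refl_cot //= exprS; split; ring.
(* The axis of this reflection passes through (1, 0), so the numerator of x.1 - 1 enters. *)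
- pose Z p q := X p q - (p + q) * cot_den p q ^+ h.
  have hZ : int_poly (4 * h + 1) Z by apply: int_poly_sub.
  exists (fun p q => cot_den p q * ((p + q) * cot_den p q ^+ h) +
       (1%:R + p ^+ 2) * ((q ^+ 2 - 1%:R) * Z p q - 2%:R * q * Y p q)),
    (fun p q => (1%:R + p ^+ 2) * ((1%:R - q ^+ 2) * Y p q - 2%:R * q * Z p q)).
  split.
  + apply: int_poly_add; first exact: int_poly_leq deg (int_poly_mul int_poly_den sD).
    apply: int_poly_leq deg' (int_poly_mul pD _).
    exact: int_poly_sub (int_poly_mul qB hZ) (int_poly_mul q1 hY).
  + apply: int_poly_leq deg' (int_poly_mul pD _).
    exact: int_poly_sub (int_poly_mul qB' hY) (int_poly_mul q1 hZ).
  move=> p q s0; rewrite /Z; have [<- <-] := E p q s0; rewrite refl_cot //= exprS.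
  by rewrite /cot_den; split; field; rewrite ?sq.
- exists (fun p q => (1%:R + q ^+ 2) * ((p ^+ 2 - 1%:R) * X p q + 2%:R * p * Y p q)),
    (fun p q => (1%:R + q ^+ 2) * ((1%:R - p ^+ 2) * Y p q + 2%:R * p * X p q)).
  split.
  + apply: int_poly_leq deg' (int_poly_mul qD _).
    exact: int_poly_add (int_poly_mul pB hX) (int_poly_mul p1 hY).
  + apply: int_poly_leq deg' (int_poly_mul qD _).
    exact: int_poly_add (int_poly_mul pB' hY) (int_poly_mul p1 hX).
  move=> p q s0; have [<- <-] := E p q s0; rewrite refl_cot //= exprS.
  by rewrite /cot_den; split; field; rewrite ?sq.
Qed.

Lemma rational_unf c i :
  rational_point (size c) (fun p q => unf (cot_vtx p q) c (cot_vtx p q i)).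
Proof. by elim: c => [|j c IH]; [apply: rational_vtx | apply: rational_refl]. Qed.

(* The triangle of three unfolded vertices, up to the motion that brings the
   first one back to the initial triangle. *)
Definition gap_form (V : 'I_3 -> pt) b m (i1 i2 i3 : 'I_3) :=
  cross (vsub (unf V b (V i3)) (V i1)) (vsub (unf V (take m b) (V i2)) (V i1)).

(** The form is quadratic in coordinate differences, so the common denominator is squared and its
    degree bound doubled. *)
Lemma gap_form_int_poly b m i1 i2 i3 : exists2 f, int_poly (8 * size b + 2) f &
  forall p q, p + q != 0 ->
    ((p + q) * cot_den p q ^+ size b) ^+ 2 *
      gap_form (cot_vtx p q) b m i1 i2 i3 = f p q.
Proof.
have [X1 [Y1 [hX1 hY1 E1]]] := rational_point_lift (leq0n (size b)) (rational_vtx i1).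
have [X3 [Y3 [hX3 hY3 E3]]] := rational_unf b i3.
have mb : (size (take m b) <= size b)%N by rewrite size_take_min geq_minr.
have [X2 [Y2 [hX2 hY2 E2]]] := rational_point_lift mb (rational_unf (take m b) i2).
exists (fun p q => (X3 p q - X1 p q) * (Y2 p q - Y1 p q) - (Y3 p q - Y1 p q) * (X2 p q - X1 p q)).
  have deg : ((4 * size b + 1) + (4 * size b + 1) <= 8 * size b + 2)%N by lia.
  apply: int_poly_leq deg _.
  by apply: int_poly_sub; apply: int_poly_mul; apply: int_poly_sub.
move=> p q s0; have [<- <-] := E1 p q s0; have [<- <-] := E2 p q s0.
have [<- <-] := E3 p q s0; rewrite /gap_form /cross /vsub /=; ring.
Qed.

End PolynomialPositions.

(** * Almost every triangle is well separated *)

Section Separation.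
Variable R : realType.
Local Notation mu2 := ((@lebesgue_measure R) \x (@lebesgue_measure R))%E.

(** The factor 256^(h+1) absorbs the number of forms for words of length [h], their degree, and a
    2^(h+1) that makes the sum over [h] converge; 2^j makes the total measure arbitrarily small. *)
Definition threshold j h : R := (2 ^ j * 256 ^ h.+1)%:R^-1.

Lemma threshold_itv j h : 0 < threshold j h <= 1.
Proof.
have n0 : (0 < 2 ^ j * 256 ^ h.+1)%N by rewrite muln_gt0 !expn_gt0.
rewrite /threshold invr_gt0 ltr0n n0 /= invf_le1 ?ltr0n // ler1n.
exact: n0.
Qed.

Definition well_separated j (p q : R) := forall b m i1 i2 i3, (m <= size b)%N ->
  gap_form (cot_vtx p q) b m i1 i2 i3 = 0 \/
  threshold j (size b) ^+ ((8 * size b + 2) + (8 * size b + 2)) <=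
    `|((p + q) * cot_den p q ^+ size b) ^+ 2 * gap_form (cot_vtx p q) b m i1 i2 i3|.

Definition gap_index h := ('I_h.+1 * 'I_3 * 'I_3 * 'I_3 * h.-tuple 'I_3)%type.

Lemma card_gap_index_le h :
  (#|{: gap_index h}| * (8 * h + 2) * 2 ^ h.+1 <= 27 * 256 ^ h.+1)%N.
Proof.
rewrite !card_prod card_tuple !card_ord.
have e1 : (h.+1 <= 2 ^ h)%N by apply: ltn_expl.
have e2 : (8 * h + 2 <= 8 * 2 ^ h)%N by lia.
have e3 : (3 ^ h * 2 ^ h * 2 ^ h * 2 ^ h <= 256 ^ h)%N.
  by case: h {e1 e2} => // h; rewrite -!expnMn leq_exp2r.
have := leq_mul e1 e2; rewrite !expnS.
set x := (2 ^ h)%N in e1 e2 e3 *; set y := (3 ^ h)%N in e3 *; set z := (256 ^ h)%N in e3 *.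
move=> h12.
have -> : (h.+1 * 3 * 3 * 3 * y * (8 * h + 2) * (2 * x) = 27 * (h.+1 * (8 * h + 2) * (y * (2 * x))))%N by lia.
rewrite leq_mul2l /=; apply: leq_trans (leq_mul h12 (leqnn _)) _.
have -> : (x * (8 * x) * (y * (2 * x)) = 16 * (y * x * x * x))%N by nia.
by apply: leq_mul.
Qed.

Lemma gap_poly h (e : gap_index h) : exists P, bidegree_le (8 * h + 2) P /\
  forall p q : R, p + q != 0 ->
    ((p + q) * cot_den p q ^+ h) ^+ 2 *
      gap_form (cot_vtx p q) e.2 e.1.1.1.1 e.1.1.1.2 e.1.1.2 e.1.2 = eval2 P p q.
Proof.
have [f [P [dP fP]] E] := gap_form_int_poly R e.2 e.1.1.1.1 e.1.1.1.2 e.1.1.2 e.1.2.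
rewrite size_tuple in dP E; exists P; split=> // p q s0.
by rewrite -fP -E.
Qed.

Definition small_set j h (e : gap_index h) : set (R * R) :=
  let P := projT1 (cid (gap_poly e)) in
  if P == 0 then set0
  else sublevel P (threshold j h ^+ ((8 * h + 2) + (8 * h + 2))).

Lemma small_set_measure j h (e : gap_index h) : measurable (small_set j e) /\
  (mu2 (small_set j e) <= (4 * pi * (8 * h + 2)%:R * threshold j h)%:E)%E.
Proof.
rewrite /small_set; set P := projT1 _; have [dP _] := projT2 (cid (gap_poly e)).
have [t0 t1] := andP (threshold_itv j h).
case: eqP => [_|/eqP P0].
  rewrite measure0 lee_fin; split; first exact: measurable0.
  by rewrite !mulr_ge0 ?pi_ge0 // ltW.
split; first exact: measurable_sublevel.
by apply: sublevel_measure => //; apply: threshold_itv.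
Qed.

Definition small_level j h : set (R * R) :=
  \big[setU/set0]_(e <- enum {: gap_index h}) small_set j e.

Lemma small_level_measure j h : measurable (small_level j h) /\
  (mu2 (small_level j h) <= (108 * pi / (2 ^ j)%:R / (2 ^ h.+1)%:R)%:E)%E.
Proof.
have bound (s : seq (gap_index h)) :
    measurable (\big[setU/set0]_(e <- s) small_set j e) /\
    (mu2 (\big[setU/set0]_(e <- s) small_set j e) <=
      ((size s)%:R * (4 * pi * (8 * h + 2)%:R * threshold j h))%:E)%E.
  elim: s => [|e s [mB IH]]; first by rewrite big_nil measure0 mul0r.
  rewrite big_cons; have [me le] := small_set_measure j e.
  split; first exact: measurableU.
  apply: (@le_trans _ _ (mu2 (small_set j e) +
    mu2 (\big[setU/set0]_(e <- s) small_set j e))%E).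
    exact: measureU2.
  apply: le_trans (leeD le IH) _.
  by rewrite -EFinD lee_fin /= -(natr1 (size s)) le_eqVlt; apply/orP; left; apply/eqP; ring.
have [mB le] := bound (enum {: gap_index h}); split=> //.
apply: le_trans le _; rewrite lee_fin -cardE.
have := card_gap_index_le h; set N := #|_|; rewrite -(ler_nat R) !natrM => hN.
have p1 : 0 < (2 ^ h.+1)%:R :> R by rewrite ltr0n expn_gt0.
have p2 : 0 < (2 ^ j)%:R :> R by rewrite ltr0n expn_gt0.
have p3 : 0 < (256 ^ h.+1)%:R :> R by rewrite ltr0n expn_gt0.
rewrite /threshold natrM; move: (2 ^ h.+1)%:R (2 ^ j)%:R (256 ^ h.+1)%:R p1 p2 p3 hN.
move=> x y z x0 y0 z0 hN; rewrite ler_pdivlMr // ler_pdivlMr //.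
have -> : N%:R * (4 * pi * (8 * h + 2)%:R * (y * z)^-1) * x * y =
    4 * pi * (N%:R * (8 * h + 2)%:R * x / z) :> R.
  by field; rewrite !gt_eqF.
have -> : 108 * pi = 4 * pi * 27 :> R by ring.
by rewrite ler_wpM2l ?mulr_ge0 ?pi_ge0 // ler_pdivrMr.
Qed.

Definition small_union j : set (R * R) := \bigcup_h small_level j h.

Lemma small_union_measure j : measurable (small_union j) /\
  (mu2 (small_union j) <= (108 * pi / (2 ^ j)%:R)%:E)%E.
Proof.
have m h := (small_level_measure j h).1.
have mU : measurable (small_union j) by apply: bigcup_measurable => h _.
split=> //; apply: le_trans (measure_sigma_subadditive mu2 m mU (@subset_refl _ _)) _.
have e0 : 0 <= 108 * pi / (2 ^ j)%:R :> R by rewrite divr_ge0 ?mulr_ge0 ?pi_ge0.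
apply: le_trans (epsilon_trick0 xpredT e0).
apply: lee_nneseries => [h _ _|h _]; first exact: measure_ge0.
by have [] := small_level_measure j h.
Qed.

(** A pair separated for no [j] lies in every [small_union j], whose measure is O(2^-j). *)
Lemma separated_ae : mu2.-negligible
  [set z : R * R | [/\ 0 < z.1 < pi, 0 < z.2 < pi, cotg z.1 + cotg z.2 != 0 &
     ~ exists j, well_separated j (cotg z.1) (cotg z.2)]].
Proof.
have mU j := (small_union_measure j).1.
have mI : measurable (\bigcap_j small_union j) by apply: bigcap_measurable.
exists (\bigcap_j small_union j); split=> //.
  apply/eqP; rewrite eq_le measure_ge0 andbT.
  apply/lee_addgt0Pr => e e0; rewrite add0e.
  have [j je] : exists j, 108 * pi / (2 ^ j)%:R <= e :> R.
    have c0 : 0 <= 108 * pi / e :> R by rewrite divr_ge0 ?mulr_ge0 ?pi_ge0 // ltW.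
    exists (Num.bound (108 * pi / e)).
    rewrite ler_pdivrMr ?ltr0n ?expn_gt0 // -ler_pdivrMl // mulrC.
    by rewrite (le_trans (ltW (archi_boundP c0))) // ler_nat ltnW // ltn_expl.
  apply: (@le_trans _ _ (mu2 (small_union j))).
    by apply: le_measure; [exact: mem_set | by apply/mem_set; apply: mU | exact: bigcap_inf].
  apply: le_trans (small_union_measure j).2 _.
  by rewrite lee_fin.
move=> z [z1 z2 s0 nsep] j _; apply: contrapT => nU; apply: nsep; exists j.
move=> b m i1 i2 i3 mb; apply: contrapT => /not_orP[n0 /negP]; rewrite -ltNge => lt.
apply: nU; exists (size b) => //.
pose e : gap_index (size b) := (Ordinal (mb : m < (size b).+1)%N, i1, i2, i3, in_tuple b).
rewrite /small_level -bigcup_seq; exists e; first by rewrite /= mem_enum.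
rewrite /small_set; set P := projT1 _.
have [_ E] := projT2 (cid (gap_poly e)); rewrite -/P in E.
have {}E := E _ _ s0; rewrite /= in E.
(* If the polynomial is zero, the form vanishes at this pair, its denominator being nonzero; this
   contradicts [n0]. *)
case: eqP => [P0|_].
  apply: n0; move: E; rewrite P0 /eval2 rmorph0 horner0 => /eqP.
  have sq (t : R) : 1 + t ^+ 2 != 0 by rewrite gt_eqF // ltr_pwDl // sqr_ge0.
  rewrite mulf_eq0 expf_eq0 /= mulf_eq0 (negbTE s0) /= expf_eq0.
  rewrite (_ : cot_den _ _ == 0 = false) ?andbF /=; first by move/eqP.
  by rewrite /cot_den mulf_eq0 !(negbTE (sq _)).
split; first by rewrite /square /= !in_itv.
by rewrite /= -E.
Qed.

End Separation.

(** * Trees with expensive turns *)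

Section Spine.
Variables (R : realDomainType) (T : eqType) (A : seq T) (k : T -> nat) (phi : T -> R).
Variables (n g : nat).
Hypothesis A_uniq : uniq A.
Hypothesis phi_inj : {in A &, injective phi}.
Hypothesis k_le : {in A, forall x, (k x <= n)%N}.
Hypothesis meet : {in A &, forall x y, phi x < phi y -> k x = k y ->
  exists2 z, z \in A & phi x < phi z < phi y /\ (k z < k x)%N}.

Definition interval_count (x y : R) := count (fun z => x < phi z < y) A.

Lemma interval_min x y : (0 < interval_count x y)%N ->
  exists2 w, w \in A & x < phi w < y /\
    {in A, forall z, x < phi z < y -> (k w <= k z)%N}.
Proof.
rewrite -has_count => /hasP[z0 z0A z0P].
have ex : exists m, has (fun z => (x < phi z < y) && (k z == m)) A.
  by exists (k z0); apply/hasP; exists z0; rewrite // z0P eqxx.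
have [m /hasP[w wA /andP[wP /eqP wm]] mmin] := ex_minnP ex.
exists w => //; split=> // z zA zP; rewrite wm; apply: mmin.
by apply/hasP; exists z; rewrite // zP eqxx.
Qed.

Lemma interval_count_split x y w : w \in A ->
  (interval_count x y <= interval_count x (phi w) + 1 + interval_count (phi w) y)%N.
Proof.
move=> wA; rewrite /interval_count.
have w1 : (count (pred1 w) A <= 1)%N by rewrite count_uniq_mem // leq_b1.
have sub2 (a1 a2 : pred T) : (count (predU a1 a2) A <= count a1 A + count a2 A)%N.
  by rewrite -count_predUI leq_addr.
set a1 := fun z : T => x < phi z < phi w; set a2 := fun z : T => phi w < phi z < y.
apply: leq_trans (_ : count (predU (predU a1 (pred1 w)) a2) A <= _)%N; last first.
  by rewrite (leq_trans (sub2 _ _)) // leq_add2r (leq_trans (sub2 _ _)) // leq_add2l.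
rewrite -!size_filter; apply: uniq_leq_size; first exact: filter_uniq.
move=> z; rewrite !mem_filter => /andP[/andP[xz zy] zA]; rewrite zA andbT /=.
rewrite /a1 /a2 xz zy andbT /=.
by case: (ltgtP (phi z) (phi w)) => [_|_|e]; rewrite ?orbT // (phi_inj zA wA e) eqxx.
Qed.

(** By [meet], two elements of equal depth [k] have a shallower one between them, so the minimum of
    [k] on an interval is attained once. Taking minima recursively makes [A] a binary search
    tree. *)
Lemma min_strict x y w z : w \in A -> z \in A -> x < phi w < y -> x < phi z < y ->
  {in A, forall t, x < phi t < y -> (k w <= k t)%N} -> phi z != phi w ->
  (k w < k z)%N.
Proof.
move=> wA zA /andP[xw wy] /andP[xz zy] wmin nzw.
rewrite ltn_neqAle wmin ?xz ?zy // andbT; apply/eqP => e.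
case: (ltgtP (phi z) (phi w)) nzw => // [lt|lt] _.
  have [t tA [/andP[t1 t2] kt]] := meet zA wA lt (esym e).
  have := wmin t tA; rewrite (lt_trans xz t1) (lt_trans t2 wy) => /(_ isT).
  by rewrite e leqNgt kt.
have [t tA [/andP[t1 t2] kt]] := meet wA zA lt e.
have := wmin t tA; rewrite (lt_trans xw t1) (lt_trans t2 zy) => /(_ isT).
by rewrite leqNgt kt.
Qed.

Hypothesis zigzag : {in A & &, forall u w c, phi u < phi c < phi w ->
  (k u < k w < k c)%N ->
  {in A, forall x, phi u < phi x < phi w -> (k c <= k x)%N} -> (k u + g < k c)%N}.

(** Follow the right spine from [u]; its next node [w] is the minimum of the interval. What lies
    between [u] and [w] is reached by a turn, so [zigzag] puts it deeper than K + g and [HB] bounds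
    it by [B]. Depth increases along the spine, so at most n - k u nodes follow [u]. *)
Lemma spine_count K B e u y :
  (forall x z, {in A, forall t, x < phi t < z -> (K + g < k t)%N} ->
     (interval_count x z <= B)%N) ->
  u \in A -> (K <= k u)%N -> (n - k u <= e)%N ->
  {in A, forall z, phi u < phi z < y -> (k u < k z)%N} ->
  (interval_count (phi u) y <= e * B.+1)%N.
Proof.
move=> HB; elim: e u => [|e IH] u uA Ku ue umin.
  rewrite leqNgt; apply/negP => /interval_min[w wA [wP _]].
  have := umin w wA wP; have := k_le wA; move: ue; rewrite leqn0 subn_eq0.
  by move=> h1 h2 /leq_trans /(_ h2); rewrite ltnNge h1.
case: (posnP (interval_count (phi u) y)) => [-> //|/interval_min[w wA [wP wmin]]].
have [uw wy] := andP wP.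
have kuw := umin w wA wP.
apply: leq_trans (interval_count_split _ _ wA) _.
have right : (interval_count (phi w) y <= e * B.+1)%N.
  apply: IH => //; first exact: leq_trans (ltnW kuw).
    by move: ue kuw (k_le wA); clear; lia.
  move=> z zA /andP[wz zy]; apply: (min_strict wA zA wP _ wmin).
    by rewrite (lt_trans uw wz) zy.
  by rewrite gt_eqF.
have middle : (interval_count (phi u) (phi w) <= B)%N.
  apply: HB => t tA tP.
  have t0 : (0 < interval_count (phi u) (phi w))%N.
    by rewrite /interval_count -has_count; apply/hasP; exists t.
  have [c cA [cP cmin]] := interval_min t0.
  have kwc : (k w < k c)%N.
    have [uc cw] := andP cP.
    apply: (min_strict wA cA wP _ wmin); first by rewrite uc (lt_trans cw wy).
    by rewrite lt_eqF.
  have := zigzag uA wA cA cP; rewrite kuw kwc => /(_ isT cmin) h.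
  by apply: leq_trans (cmin t tA tP); apply: leq_ltn_trans h; rewrite leq_add2r.
by rewrite mulSn; apply: leq_add => //; rewrite addn1.
Qed.
End Spine.

Section Counting.
Variables (R : realDomainType) (T : eqType) (A : seq T) (k : T -> nat) (phi : T -> R).
Variables (n g : nat).
Hypothesis A_uniq : uniq A.
Hypothesis phi_inj : {in A &, injective phi}.
Hypothesis k_le : {in A, forall x, (k x <= n)%N}.
Hypothesis meet : {in A &, forall x y, phi x < phi y -> k x = k y ->
  exists2 z, z \in A & phi x < phi z < phi y /\ (k z < k x)%N}.
Hypothesis zigzag_right : {in A & &, forall u w c, phi u < phi c < phi w ->
  (k u < k w < k c)%N ->
  {in A, forall x, phi u < phi x < phi w -> (k c <= k x)%N} -> (k u + g < k c)%N}.
Hypothesis zigzag_left : {in A & &, forall u w c, phi w < phi c < phi u ->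
  (k u < k w < k c)%N ->
  {in A, forall x, phi w < phi x < phi u -> (k c <= k x)%N} -> (k u + g < k c)%N}.

Let psi x := - phi x.

Lemma interval_count_opp x y :
  interval_count A psi x y = interval_count A phi (- y) (- x).
Proof.
by apply: eq_count => z; rewrite /psi ltrNr ltrNl andbC.
Qed.

(** Every turn uses up at least g + 1 of the depth, so [f] bounds the number of levels of turns. The
    minimum splits the interval into two spines; with B + 1 = (2n + 2)^f the total is at most 2n(B +
    1) + 1, which is below (2n + 2)^(f+1). *)
Lemma interval_count_lt f K x y : (n < K + f * g.+1)%N ->
  {in A, forall z, x < phi z < y -> (K <= k z)%N} ->
  (interval_count A phi x y < (2 * n + 2) ^ f)%N.
Proof.
elim: f K x y => [|f IH] K x y nK Kmin.
  rewrite expn0 ltnS leqNgt; apply/negP => /(interval_min k)[w wA [wP _]].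
  by have := leq_ltn_trans (k_le wA) nK; rewrite addn0 ltnNge Kmin.
case: (posnP (interval_count A phi x y)) => [->|].
  by rewrite expn_gt0 addn2.
move=> /(interval_min k)[u uA [uP umin]].
have [xu uy] := andP uP.
set B := ((2 * n + 2) ^ f).-1.
have BE : B.+1 = ((2 * n + 2) ^ f)%N by rewrite prednK // expn_gt0 addn2.
have Ku := Kmin u uA uP.
have nK' : (n < (K + g).+1 + f * g.+1)%N by move: nK; clear; lia.
have right : (interval_count A phi (phi u) y <= n * B.+1)%N.
  apply: (spine_count A_uniq phi_inj k_le meet zigzag_right) Ku (leq_subr _ _) _ => //.
    by move=> x' z' h; rewrite -ltnS BE; apply: IH nK' _ => t tA /(h t tA).
  move=> z zA /andP[uz zy]; apply: (min_strict meet uA zA uP _ umin).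
    by rewrite (lt_trans xu uz) zy.
  by rewrite gt_eqF.
have left : (interval_count A phi x (phi u) <= n * B.+1)%N.
  (* The left spine is a right spine for the reversed order [psi]. *)
  rewrite -[x]opprK -[phi u]opprK -interval_count_opp -/(psi u).
  apply: (spine_count (g := g) A_uniq _ k_le) Ku (leq_subr _ _) _ => //.
  - by move=> a b aA bA /oppr_inj; apply: phi_inj.
  - move=> a b aA bA; rewrite /psi ltrN2 => lt e.
    have [z zA [/andP[z1 z2] kz]] := meet bA aA lt (esym e).
    by exists z => //; rewrite !ltrN2 z1 z2 e.
  - move=> a w c aA wA cA; rewrite /psi !ltrN2 andbC => P1 P2 P3.
    apply: (zigzag_left aA wA cA) => // t tA; rewrite andbC => tP; apply: P3 => //.
    by rewrite !ltrN2.
  - move=> x' z' h; rewrite -ltnS BE interval_count_opp; apply: IH nK' _ => t tA tP.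
    by apply: h => //; rewrite /psi ltrNr ltrNl andbC.
  move=> z zA; rewrite /psi !ltrN2 => /andP[zu xz].
  apply: (min_strict meet uA zA uP _ umin); first by rewrite xz (lt_trans zu uy).
  by rewrite lt_eqF.
apply: leq_ltn_trans (interval_count_split A_uniq phi_inj _ _ uA) _.
rewrite expnS -BE; move: left right; clear; nia.
Qed.

Lemma size_zigzag_lt x y : {in A, forall z, x < phi z < y} ->
  (size A < (2 * n + 2) ^ (n %/ g.+1).+1)%N.
Proof.
move=> all_in.
have -> : size A = interval_count A phi x y.
  by rewrite -(count_predT A); apply: eq_in_count => z /all_in ->.
by apply: (@interval_count_lt _ 0%N) => //; rewrite add0n ltn_ceil.
Qed.

End Counting.

(** * Counting diagonals *)

Section Complexity.
Variables (R : realType) (V : 'I_3 -> R * R) (v : 'I_3).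
Hypothesis area_gt0 : 0 < area2 V ord0.
Notation pt := (R * R)%type.

Lemma sqr_le_abs_le (x M : R) : 1 <= M -> x ^+ 2 <= M -> `|x| <= M.
Proof.
move=> M1 xM; have M0 : 0 <= M := le_trans ler01 M1.
rewrite -(ler_pXn2r (ltn0Sn 1)) ?nnegrE //.
rewrite -normrX ger0_norm ?sqr_ge0 //; apply: le_trans xM _.
by rewrite expr2 ler_peMl.
Qed.

(** Up to isometry, reflecting the current copy displaces a vertex by one of nine fixed vectors, so
    unfolded positions grow at most linearly. *)
Lemma tip_bound : exists2 K, 0 <= K & forall c,
  `|(tip V v c).1| <= K * (size c).+1%:R /\ `|(tip V v c).2| <= K * (size c).+1%:R.
Proof.
pose d i j := vsub (refl V j (V i)) (V i).
pose M : R := 1 + \sum_i \sum_j dot (d i j) (d i j) + \sum_i (`|(V i).1| + `|(V i).2|).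
have dot_ge0 (x : pt) : 0 <= dot x x by rewrite /dot -!expr2 addr_ge0 ?sqr_ge0.
have s1 : 0 <= \sum_i \sum_j dot (d i j) (d i j).
  by apply: sumr_ge0 => i _; apply: sumr_ge0.
have s2 : 0 <= \sum_i (`|(V i).1| + `|(V i).2|).
  by apply: sumr_ge0 => i _; rewrite addr_ge0.
have M1 : 1 <= M by rewrite /M; lra.
have VM i : `|(V i).1| <= M /\ `|(V i).2| <= M.
  have h : `|(V i).1| + `|(V i).2| <= \sum_i (`|(V i).1| + `|(V i).2|).
    rewrite [leRHS](bigD1 i) //= lerDl; apply: sumr_ge0 => k _; exact: addr_ge0.
  have := normr_ge0 (V i).1; have := normr_ge0 (V i).2; rewrite /M; lra.
have dM i j : dot (d i j) (d i j) <= M.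
  apply: le_trans (_ : \sum_i \sum_j dot (d i j) (d i j) <= _).
    rewrite [leRHS](bigD1 i) //= (bigD1 j) //= -addrA lerDl addr_ge0 //.
      exact: sumr_ge0.
    by apply: sumr_ge0 => k _; apply: sumr_ge0.
  by rewrite /M; lra.
have posM c i : `|(unf V c (V i)).1| <= M * (size c).+1%:R /\
                `|(unf V c (V i)).2| <= M * (size c).+1%:R.
  elim/last_ind: c i => [|c j IH] i; first by rewrite /= mulr1.
  have [h1 h2] := IH i.
  have := vsub_unf area_gt0 c (refl V j (V i)) (V i); rewrite -/(d i j) -unf_rcons.
  have : dot (unfl V c (d i j)) (unfl V c (d i j)) <= M by rewrite dot_unfl.
  set e := unfl V c _; rewrite /dot -!expr2 => eM ee.
  have e1 : `|e.1| <= M.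
    by apply: sqr_le_abs_le => //; apply: le_trans eM; rewrite lerDl sqr_ge0.
  have e2 : `|e.2| <= M.
    by apply: sqr_le_abs_le => //; apply: le_trans eM; rewrite lerDr sqr_ge0.
  have -> : unf V (rcons c j) (V i) = vadd (unf V c (V i)) e.
    by rewrite -ee [LHS]surjective_pairing /vadd /vsub /=; congr pair; ring.
  rewrite size_rcons -(natr1 (size c).+1) mulrDr mulr1 /vadd /=.
  by split; apply: le_trans (ler_normD _ _) _; apply: lerD.
exists (M + M); first lra.
move=> c; have [h1 h2] := posM c (nextv (nextv (last ord0 c))).
have [h3 h4] := VM v.
have n1 : 1 <= (size c).+1%:R :> R by rewrite ler1n.
have Mn : M <= M * (size c).+1%:R by rewrite ler_peMr //; lra.
rewrite /tip /vsub /= mulrDl; split; apply: le_trans (ler_normB _ _) _; lra.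
Qed.

Let r := endr V v [:: nextv v].
Let l := endl V v [:: nextv v].

Let rl_gt0 : 0 < cross r l.
Proof. exact: ends1_gt0. Qed.

(** The parameter at which the ray to the tip crosses the side opposite [v], from 0 at [r] to 1 at
    [l]. Equal subdivisions of it will be the sectors. *)
Definition slope c := cross r (tip V v c) / (cross r (tip V v c) + cross (tip V v c) l).

Lemma slope_itv c : admissible V v c -> 0 < slope c < 1.
Proof.
move=> ac; have [h1 h2] := admissible_cone area_gt0 ac.
have h3 := addr_gt0 h1 h2.
by rewrite /slope; apply/andP; split; [exact: divr_gt0 | rewrite ltr_pdivrMr // mul1r ltrDl].
Qed.

(** Turns closeness of slopes into a small cross product: the other two factors are at most linear
    in the word lengths. *)
Lemma slope_sub c1 c2 : admissible V v c1 -> admissible V v c2 ->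
  cross r l * cross (tip V v c1) (tip V v c2) =
  (slope c2 - slope c1) * (cross r (tip V v c1) + cross (tip V v c1) l)
                        * (cross r (tip V v c2) + cross (tip V v c2) l).
Proof.
move=> a1 a2; have [h1 h2] := admissible_cone area_gt0 a1; have [h3 h4] := admissible_cone area_gt0 a2.
have n1 := lt0r_neq0 (addr_gt0 h1 h2); have n2 := lt0r_neq0 (addr_gt0 h3 h4).
rewrite /slope -/r -/l in n1 n2 *.
have -> : forall x1 y1 x2 y2 : R, y1 != 0 -> y2 != 0 ->
    (x2 / y2 - x1 / y1) * y1 * y2 = x2 * y1 - x1 * y2.
  by move=> x1 y1 x2 y2 y10 y20; field; rewrite y10 y20.
- by rewrite /cross; ring.
- exact: n1.
- exact: n2.
Qed.

Lemma slope_lt c1 c2 : admissible V v c1 -> admissible V v c2 ->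
  (slope c1 < slope c2) = (0 < cross (tip V v c1) (tip V v c2)).
Proof.
move=> a1 a2; have [h1 h2] := admissible_cone area_gt0 a1; have [h3 h4] := admissible_cone area_gt0 a2.
rewrite -(pmulr_rgt0 _ rl_gt0) slope_sub // !pmulr_lgt0 ?subr_gt0 //; exact: addr_gt0.
Qed.

Lemma slope_between c1 c2 c : admissible V v c1 -> admissible V v c2 ->
  admissible V v c -> slope c1 < slope c2 ->
  between (tip V v c1) (tip V v c2) (tip V v c) <-> slope c1 < slope c < slope c2.
Proof.
move=> a1 a2 a lt; rewrite /between -!slope_lt //; split.
  case=> [[-> -> //]|[h1 h2]].
  by have := lt_trans (lt_trans h1 h2) lt; rewrite ltxx.
by move=> /andP[-> ->]; left.
Qed.

Lemma slope_inj c1 c2 : admissible V v c1 -> admissible V v c2 ->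
  slope c1 = slope c2 -> c1 = c2.
Proof.
move=> a1 a2 e; apply/eqP; apply: contraT => n.
have := admissible_neq area_gt0 a1 a2 n.
have := slope_lt a1 a2; have := slope_lt a2 a1; rewrite e ltxx -crossC_lt0.
by case: ltgtP.
Qed.

Definition words n : seq (seq 'I_3) :=
  undup [seq bseqval c | c <- enum {: n.-bseq 'I_3} & `[< admissible V v (bseqval c) >]].

Lemma mem_words n c : (c \in words n) <-> (size c <= n)%N /\ admissible V v c.
Proof.
rewrite /words mem_undup; split.
  move=> /mapP[s]; rewrite mem_filter => /andP[/asboolP ac _] ->; split=> //.
  exact: size_bseq.
move=> [sc ac]; apply/mapP; exists (Bseq sc) => //.
by rewrite mem_filter mem_enum /=; apply/andP; split=> //; apply/asboolP.
Qed.

Lemma tip_cone_bound : exists2 E, 0 < E & forall c, admissible V v c ->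
  cross r (tip V v c) + cross (tip V v c) l <= E * (size c).+1%:R.
Proof.
have [K K0 HK] := tip_bound.
have rn := normr_ge0 r.1; have rn' := normr_ge0 r.2.
have ln := normr_ge0 l.1; have ln' := normr_ge0 l.2.
exists (K * (`|r.1| + `|r.2| + `|l.1| + `|l.2|) + 1).
  by rewrite ltr_wpDl // mulr_ge0 //; lra.
move=> c _; have [h1 h2] := HK c; move: (tip V v c) h1 h2 => x h1 h2.
set y := K * _ in h1 h2.
have y0 : 0 <= y by rewrite mulr_ge0.
have prod a b : `|b| <= y -> a * b <= `|a| * y.
  by move=> h; rewrite (le_trans (ler_norm _)) // normrM ler_wpM2l.
have prodN a b : `|b| <= y -> - (a * b) <= `|a| * y.
  by rewrite -mulNr -(normrN a); apply: prod.
have := prod r.1 x.2 h2; have := prodN r.2 x.1 h1.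
have := prod l.2 x.1 h1; have := prodN l.1 x.2 h2.
have -> : (K * (`|r.1| + `|r.2| + `|l.1| + `|l.2|) + 1) * (size c).+1%:R =
  `|r.1| * y + `|r.2| * y + `|l.1| * y + `|l.2| * y + (size c).+1%:R.
  by rewrite /y; ring.
have n0 : 0 <= (size c).+1%:R :> R by [].
rewrite /cross (mulrC x.1) (mulrC x.2); lra.
Qed.

(** All three points carry the motion [unf V u]; removing it costs only a sign and leaves the word
    from [u] to [c]. *)
Lemma triple_gap_form u w c : admissible V v u -> (size u < size w < size c)%N ->
  u = take (size u) c -> w = take (size w) c -> exists i1 i2 i3,
  cross (vsub (tip V v c) (tip V v u)) (vsub (tip V v w) (tip V v u)) =
  (-1) ^+ size u *
    gap_form V (drop (size u) c) (size w - size u) i1 i2 i3.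
Proof.
move=> au /andP[uw wc] eu ew.
exists (nextv (nextv (last ord0 u))), (nextv (nextv (last ord0 w))),
  (nextv (nextv (last ord0 c))).
have ec : c = u ++ drop (size u) c by rewrite {1}eu cat_take_drop.
have ew' : w = u ++ take (size w - size u) (drop (size u) c).
  rewrite {1}ew -[in LHS](subnKC (ltnW uw)) takeD -eu; congr (_ ++ _).
rewrite /tip !vsub_vsub /gap_form.
rewrite [in unf V c]ec [in unf V w]ew' !unf_cat.
by rewrite !(vsub_unf area_gt0) (cross_unfl area_gt0).
Qed.

Variables (j : nat) (p q : R).
Hypothesis pq0 : p + q != 0.
Hypothesis V_cot : V = cot_vtx p q.
Hypothesis sep : well_separated j p q.

Definition min_gap g : R := threshold R j g ^+ ((8 * g + 2) + (8 * g + 2)) /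
  ((p + q) * cot_den p q ^+ g) ^+ 2.

Let den_ge1 : 1 <= cot_den p q.
Proof. by rewrite /cot_den mulr_ege1 // lerDl sqr_ge0. Qed.

Lemma min_gap_gt0 g : 0 < min_gap g.
Proof.
have [t0 _] := andP (threshold_itv R j g).
apply: divr_gt0; first exact: exprn_gt0.
rewrite exprn_even_gt0 //= mulf_neq0 // expf_neq0 //.
by rewrite gt_eqF // (lt_le_trans ltr01).
Qed.

(** The bound for length [g] serves all shorter words: [threshold] decreases with the length, its
    exponent grows over a base at most 1, and [cot_den] is at least 1. *)
Lemma gap_form_ge g b m i1 i2 i3 : (size b <= g)%N -> (m <= size b)%N ->
  gap_form V b m i1 i2 i3 != 0 -> min_gap g <= `|gap_form V b m i1 i2 i3|.
Proof.
move=> bg mb; rewrite V_cot => /eqP G0; case: (sep i1 i2 i3 mb) => // h.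
rewrite /min_gap ler_pdivrMr; last first.
  rewrite exprn_even_gt0 //= mulf_neq0 // expf_neq0 //.
  by rewrite gt_eqF // (lt_le_trans ltr01).
have [t0 t1] := andP (threshold_itv R j g).
have [t0' t1'] := andP (threshold_itv R j (size b)).
apply: le_trans (_ : threshold R j (size b) ^+ (8 * size b + 2 + (8 * size b + 2)) <= _).
  apply: le_trans (_ : threshold R j g ^+ (8 * size b + 2 + (8 * size b + 2)) <= _).
    by apply: ler_wiXn2l => //; [exact: ltW | lia].
  rewrite lerXn2r ?nnegrE ?(ltW t0) ?(ltW t0') //.
  rewrite /threshold lef_pV2 ?posrE ?ltr0n ?muln_gt0 ?expn_gt0 // ler_nat.
  by rewrite leq_mul2l leq_exp2l // ltnS bg orbT.
apply: le_trans h _; rewrite normrM mulrC ler_wpM2l //.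
rewrite ger0_norm ?sqr_ge0 //; move: (cot_den p q) den_ge1 => D D1.
rewrite !exprMn ler_wpM2l ?sqr_ge0 //.
by rewrite -!exprM; apply: ler_weXn2l => //; rewrite leq_mul2r bg orbT.
Qed.

(** Twice the area of the triangle formed by the three tips is a signed sum of three cross products
    through [v], each small because the slopes are close; hence the 3. A word from [u] to [c] of
    length at most [g] would force at least [min_gap g]. *)
Lemma close_triple (E M : R) n g u w c :
  (forall c, admissible V v c ->
    cross r (tip V v c) + cross (tip V v c) l <= E * (size c).+1%:R) ->
  0 < M -> 3 * (E * n.+1%:R) ^+ 2 < M * (cross r l * min_gap g) ->
  admissible V v u -> admissible V v w -> admissible V v c ->
  (size u < size w < size c)%N -> (size c <= n)%N ->
  u = take (size u) c -> w = take (size w) c ->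
  `|slope w - slope u| <= M^-1 -> `|slope c - slope u| <= M^-1 ->
  `|slope w - slope c| <= M^-1 ->
  cross (vsub (tip V v c) (tip V v u)) (vsub (tip V v w) (tip V v u)) != 0 ->
  (size u + g < size c)%N.
Proof.
move=> HE M0 Mbig au aw ac uwc cn eu ew suw suc swc ncol.
have [uw wc] := andP uwc.
rewrite ltnNge; apply/negP => cug.
have [i1 [i2 [i3 e]]] := triple_gap_form au uwc eu ew.
have lower : min_gap g <=
    `|cross (vsub (tip V v c) (tip V v u)) (vsub (tip V v w) (tip V v u))|.
  move: ncol; rewrite e mulf_eq0 signr_eq0 /= normrM normr_sign mul1r => n0.
  apply: gap_form_ge n0; rewrite size_drop; first by rewrite leq_subLR.
  by rewrite leq_sub2r // ltnW.
have crossM c1 c2 : admissible V v c1 -> admissible V v c2 ->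
    (size c1 <= n)%N -> (size c2 <= n)%N -> `|slope c2 - slope c1| <= M^-1 ->
    cross r l * `|cross (tip V v c1) (tip V v c2)| <= M^-1 * (E * n.+1%:R) ^+ 2.
  move=> a1 a2 s1 s2 s12.
  rewrite -[X in X * _](gtr0_norm rl_gt0) -normrM slope_sub // !normrM -mulrA.
  have D a (s : (size a <= n)%N) : admissible V v a ->
      `|cross r (tip V v a) + cross (tip V v a) l| <= E * n.+1%:R.
    move=> aa; have [h1 h2] := admissible_cone area_gt0 aa.
    have E0 : 0 <= E.
      have := le_trans (ltW (addr_gt0 h1 h2)) (HE a aa).
      by rewrite pmulr_lge0 // ltr0n.
    rewrite gtr0_norm; last exact: addr_gt0.
    by apply: le_trans (HE a aa) _; rewrite ler_wpM2l // ler_nat ltnS.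
  by rewrite expr2 !ler_pM // ?mulr_ge0 //; apply: D.
have un : (size u <= n)%N by apply: leq_trans cn; apply: ltnW; apply: ltn_trans wc.
have wn : (size w <= n)%N by apply: leq_trans cn; apply: ltnW.
have b1 := crossM u w au aw un wn suw.
have b2 := crossM u c au ac un cn suc.
have b3 := crossM c w ac aw cn wn swc.
have : `|cross (vsub (tip V v c) (tip V v u)) (vsub (tip V v w) (tip V v u))| <=
    `|cross (tip V v c) (tip V v w)| + `|cross (tip V v u) (tip V v c)| +
    `|cross (tip V v u) (tip V v w)|.
  have -> : cross (vsub (tip V v c) (tip V v u)) (vsub (tip V v w) (tip V v u)) =
    cross (tip V v c) (tip V v w) + cross (tip V v u) (tip V v c) -
    cross (tip V v u) (tip V v w) by rewrite /cross /vsub /=; ring.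
  by apply: le_trans (ler_normB _ _) _; rewrite lerD2r; apply: ler_normD.
move/(le_trans lower); rewrite -(ler_pM2l rl_gt0) !mulrDr => h.
have : cross r l * min_gap g <= M^-1 * (3 * (E * n.+1%:R) ^+ 2) by lra.
by rewrite ler_pdivlMl // leNgt Mbig.
Qed.

End Complexity.

(** * Counting words sector by sector *)

Section WordCount.
Variables (R : realType) (V : 'I_3 -> R * R) (v : 'I_3).
Hypothesis area_gt0 : 0 < area2 V ord0.
Variables (j : nat) (p q : R).
Hypothesis pq0 : p + q != 0.
Hypothesis V_cot : V = cot_vtx p q.
Hypothesis sep : well_separated j p q.
Let r := endr V v [:: nextv v].
Let l := endl V v [:: nextv v].
Variables (E : R) (n g M : nat).
Hypothesis HE : forall c, admissible V v c ->
  cross r (tip V v c) + cross (tip V v c) l <= E * (size c).+1%:R.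
Hypothesis M_gt0 : (0 < M)%N.
Hypothesis M_big : 3 * (E * n.+1%:R) ^+ 2 < M%:R * (cross r l * min_gap j p q g).

Notation slope := (slope V v).
Notation words := (words V v).

Definition cell i := [seq c <- words n | Num.truncn (slope c * M%:R) == i].

Lemma mem_cell i c : c \in cell i ->
  [/\ (size c <= n)%N, admissible V v c & i%:R <= slope c * M%:R < i.+1%:R].
Proof.
rewrite mem_filter => /andP[/eqP ti /mem_words[sc ac]]; split=> //.
have [s0 _] := andP (slope_itv area_gt0 ac).
by rewrite -ti truncn_itv // mulr_ge0 // ltW.
Qed.

Lemma cell_mem i c : (size c <= n)%N -> admissible V v c ->
  i%:R <= slope c * M%:R < i.+1%:R -> c \in cell i.
Proof.
move=> sc ac h; rewrite mem_filter; apply/andP; split; last exact/mem_words.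
by apply/eqP/truncn_def.
Qed.

Lemma cell_convex i x y z : x \in cell i -> y \in cell i -> admissible V v z ->
  (size z <= n)%N -> slope x < slope z < slope y -> z \in cell i.
Proof.
move=> /mem_cell[_ _ /andP[x1 _]] /mem_cell[_ _ /andP[_ y2]] az sz /andP[xz zy].
have M0 : 0 < M%:R :> R by rewrite ltr0n.
apply: cell_mem => //; apply/andP; split.
  by apply: le_trans x1 _; rewrite ler_pM2r // ltW.
by apply: lt_trans y2; rewrite ltr_pM2r.
Qed.

Lemma cell_close i x y : x \in cell i -> y \in cell i -> `|slope x - slope y| <= M%:R^-1.
Proof.
move=> /mem_cell[_ _ /andP[x1 x2]] /mem_cell[_ _ /andP[y1 y2]].
have M0 : 0 < M%:R :> R by rewrite ltr0n.
rewrite -[leRHS]mul1r ler_pdivlMr // -[X in _ * X](gtr0_norm M0) -normrM mulrBl.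
by rewrite ler_norml -natr1 in x2 y2 *; apply/andP; split; lra.
Qed.

(** Minimality inside the cell implies minimality among all admissible words, since a shorter word
    whose tip lies between [u] and [w] belongs to the same cell. *)
Lemma cell_zigzag i u w c : u \in cell i -> w \in cell i -> c \in cell i ->
  between (tip V v u) (tip V v w) (tip V v c) ->
  (size u < size w < size c)%N ->
  (forall x, x \in cell i -> between (tip V v u) (tip V v w) (tip V v x) ->
     (size c <= size x)%N) -> (size u + g < size c)%N.
Proof.
move=> ui wi ci b uwc cmin; have [uw wc] := andP uwc.
have [un au _] := mem_cell ui; have [wn aw _] := mem_cell wi.
have [cn ac _] := mem_cell ci.
have bmin x : admissible V v x -> between (tip V v u) (tip V v w) (tip V v x) ->
    (size c <= size x)%N.
  move=> ax bx; rewrite leqNgt; apply/negP => xc.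
  have xi : x \in cell i.
    have xn : (size x <= n)%N by apply: leq_trans cn; apply: ltnW.
    case: (bx) => -[]; rewrite -!slope_lt // => h1 h2.
      by apply: (cell_convex ui wi) => //; rewrite h1 h2.
    by apply: (cell_convex wi ui) => //; rewrite h1 h2.
  by have := cmin x xi bx; rewrite leqNgt xc.
have [eu ew ncol] := triple_not_collinear area_gt0 au aw ac uw wc b bmin.
apply: (close_triple (E := E) (M := M%:R) (n := n) (u := u) (w := w) area_gt0 pq0 V_cot sep HE) => //.
- by rewrite ltr0n.
- exact: (cell_close wi ui).
- exact: (cell_close ci ui).
- exact: (cell_close wi ci).
Qed.

Lemma size_cell i : (size (cell i) < (2 * n + 2) ^ (n %/ g.+1).+1)%N.
Proof.
have slope_cross x y : x \in cell i -> y \in cell i ->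
    (slope x < slope y) = (0 < cross (tip V v x) (tip V v y)).
  by move=> /mem_cell[_ ax _] /mem_cell[_ ay _]; apply: slope_lt.
apply: (@size_zigzag_lt _ _ (cell i) size slope n g _ _ _ _ _ _ 0 1).
- exact/filter_uniq/undup_uniq.
- by move=> x y /mem_cell[_ ax _] /mem_cell[_ ay _]; apply: slope_inj.
- by move=> x /mem_cell[].
- move=> x y xi yi xy sxy.
  have [sx ax _] := mem_cell xi; have [sy ay _] := mem_cell yi.
  have [|e|[z az [sz b]]] := prefix_or_branch area_gt0 ax ay; first by rewrite sxy.
    by move: xy; rewrite e sxy take_size ltxx.
  have := (slope_between area_gt0 ax ay az xy).1 b => xzy.
  exists z => //; apply: (cell_convex xi yi) => //.
  by apply: leq_trans sx; apply: ltnW.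
- move=> u w c ui wi ci /andP[uc cw] uwc cmin.
  apply: (cell_zigzag ui wi ci) => //; first by left; rewrite -!slope_cross.
  move=> x xi bx; apply: cmin => //.
  have [_ au _] := mem_cell ui; have [_ aw _] := mem_cell wi.
  have [_ ax _] := mem_cell xi.
  exact/(slope_between area_gt0 au aw ax (lt_trans uc cw)).
- move=> u w c ui wi ci /andP[wc cu] uwc cmin.
  apply: (cell_zigzag ui wi ci) => //; first by right; rewrite -!slope_cross.
  move=> x xi bx; apply: cmin => //.
  have [_ au _] := mem_cell ui; have [_ aw _] := mem_cell wi.
  have [_ ax _] := mem_cell xi.
  exact/(slope_between area_gt0 aw au ax (lt_trans wc cu))/betweenC.
- by move=> x /mem_cell[_ ax _]; apply: slope_itv.
Qed.

Lemma size_words_le : (size (words n) <= M * (2 * n + 2) ^ (n %/ g.+1).+1)%N.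
Proof.
apply: leq_trans (_ : \sum_(i < M) size (cell i) <= _)%N; last first.
  rewrite -[X in (X * _)%N]card_ord -sum_nat_const.
  by apply: leq_sum => i _; apply/ltnW/size_cell.
have -> : (\sum_(i < M) size (cell i) =
    \sum_(c <- words n) \sum_(i < M | Num.truncn (slope c * M%:R) == i) 1)%N.
  rewrite (eq_bigr (fun i : 'I_M =>
    \sum_(c <- words n | Num.truncn (slope c * M%:R) == i) 1)%N).
    by rewrite (exchange_big_dep xpredT).
  by move=> i _; rewrite size_filter sum1_count.
rewrite -sum1_size big_seq [leqRHS]big_seq; apply: leq_sum => c /mem_words[_ ac].
have [s0 s1] := andP (slope_itv area_gt0 ac).
have M0 : 0 < M%:R :> R by rewrite ltr0n.
have tM : (Num.truncn (slope c * M%:R) < M)%N.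
  by rewrite truncn_lt_nat ?gtr_pMl // mulr_ge0 // ltW.
by rewrite (bigD1 (Ordinal tM)) //= leq_addr.
Qed.

End WordCount.

(** * Choice of the parameters and growth of the count *)

Section Subexponential.
Variable R : realType.

Lemma le_expR (x : R) : x <= expR x.
Proof. by apply: le_trans (expR_ge1Dx x); rewrite lerDr. Qed.

(** The number of sectors without its factor (n + 1)^2, constants abstracted: [D] stands for
    [cot_den], [P] for 2^j, [C] for 256, and 16g + 4 is twice the degree 8g + 2. The exponents add
    up to at most 40(g + 1)^2. *)
Lemma growth_bound (L Q D P C : R) g : 0 <= L ->
  0 <= Q <= expR L -> 0 <= D <= expR L -> 0 <= P <= expR L -> 0 <= C <= expR L ->
  Q * D ^+ (g * 2) * (P * C ^+ g.+1) ^+ (16 * g + 4) <=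
  expR (40 * L * g.+1%:R ^+ 2).
Proof.
move=> L0 /andP[Q0 QL] /andP[D0 DL] /andP[P0 PL] /andP[C0 CL].
have ge1X (x : R) k : 0 <= x -> x <= expR L -> x ^+ k <= expR (L * k%:R).
  by move=> x0 xL; rewrite mulrC expRM_natl lerXn2r ?nnegrE ?expR_ge0.
have e1 := ge1X _ (g * 2)%N D0 DL.
have e2 := ge1X _ (16 * g + 4)%N P0 PL.
have e3 := ge1X _ (g.+1 * (16 * g + 4))%N C0 CL.
rewrite exprMn -exprM.
apply: le_trans (_ : expR L * expR (L * (g * 2)%:R) *
   (expR (L * (16 * g + 4)%:R) * expR (L * (g.+1 * (16 * g + 4))%:R)) <= _).
  apply: ler_pM; first by rewrite mulr_ge0 ?exprn_ge0.
  - by rewrite mulr_ge0 ?exprn_ge0.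
  - by apply: ler_pM => //; apply: exprn_ge0.
  - by apply: ler_pM => //; apply: exprn_ge0.
rewrite -!expRD ler_expR.
have -> : L + L * (g * 2)%:R + (L * (16 * g + 4)%:R + L * (g.+1 * (16 * g + 4))%:R) =
  L * (1 + g * 2 + (16 * g + 4) + g.+1 * (16 * g + 4))%:R by rewrite !natrD; ring.
rewrite -mulrA mulrCA ler_wpM2l // -natrX -natrM ler_nat.
by clear; rewrite !expnS expn0; nia.
Qed.

Lemma words_count_le (V : 'I_3 -> R * R) (v : 'I_3) (j : nat) (p q : R) :
  0 < area2 V ord0 -> p + q != 0 -> V = cot_vtx p q -> well_separated j p q ->
  exists2 L : R, 0 <= L & forall n g,
    (size (words V v n))%:R <=
    expR (L * g.+1%:R ^+ 2) * (2 * n + 2)%:R ^+ (n %/ g.+1 + 3).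
Proof.
move=> area_gt0 pq0 V_cot sep.
have rl := ends1_gt0 area_gt0 v.
have [E E0 HE] := tip_cone_bound v area_gt0.
set rl0 := cross _ _ in rl.
pose Q := 3 * E ^+ 2 * (p + q) ^+ 2 / rl0.
have Q0 : 0 <= Q by rewrite divr_ge0 ?(ltW rl) //; do 2![apply: mulr_ge0; rewrite ?sqr_ge0 //].
have D0 : 0 <= cot_den p q by apply: mulr_ge0; rewrite addr_ge0 ?sqr_ge0.
(* As x <= exp x, each of the four constants is at most [expR L0]. *)
pose L0 := Q + cot_den p q + (2 ^ j)%:R + 256.
have L0_ge0 : 0 <= L0 by move: (ler0n R (2 ^ j)); rewrite /L0; lra.
have QL : Q <= expR L0 by apply: le_trans (le_expR _); rewrite /L0; move: (ler0n R (2 ^ j)); lra.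
have DL : cot_den p q <= expR L0 by apply: le_trans (le_expR _); rewrite /L0; move: (ler0n R (2 ^ j)); lra.
have jL : (2 ^ j)%:R <= expR L0 by apply: le_trans (le_expR _); rewrite /L0; move: (ler0n R (2 ^ j)); lra.
have cL : 256 <= expR L0 by apply: le_trans (le_expR _); rewrite /L0; move: (ler0n R (2 ^ j)); lra.
exists (40 * L0); first by rewrite mulr_ge0.
move=> n g.
have m0 := min_gap_gt0 j pq0 g.
pose X := 3 * (E * n.+1%:R) ^+ 2 / (rl0 * min_gap j p q g).
have X0 : 0 <= X by apply: divr_ge0; apply: mulr_ge0; rewrite ?sqr_ge0 ?ltW.
(* The first integer strictly above [X]. The factor (n + 1)^2 in [X] accounts for two of the three
   extra powers of 2n + 2; the third comes from rounding n / (g + 1). *)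
pose M := (Num.truncn X).+1.
have [MX1 MX2] := andP (truncn_itv X0).
have Mbig : 3 * (E * n.+1%:R) ^+ 2 < M%:R * (rl0 * min_gap j p q g).
  by rewrite -ltr_pdivrMr // mulr_gt0.
have := size_words_le area_gt0 pq0 V_cot sep HE (ltn0Sn _) Mbig.
rewrite -(ler_nat R) => /le_trans; apply.
have XE : X = Q * n.+1%:R ^+ 2 * cot_den p q ^+ (g * 2) *
    ((2 ^ j)%:R * 256 ^+ g.+1) ^+ (16 * g + 4).
  rewrite /X /Q /min_gap /threshold natrM (natrX R 256).
  have -> : (8 * g + 2 + (8 * g + 2) = 16 * g + 4)%N by clear; lia.
  set a := (2 ^ j)%:R * _; have a0 : a != 0.
    have c0 : 0 < 256 :> R by rewrite ltr0n.
    by rewrite gt_eqF // mulr_gt0 ?exprn_gt0 // ltr0n expn_gt0.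
  have d0 : cot_den p q ^+ g != 0.
    by rewrite expf_neq0 // /cot_den mulf_neq0 // gt_eqF // ltr_wpDr ?sqr_ge0.
  rewrite exprVn (exprM (cot_den p q)).
  have : a ^+ (16 * g + 4) != 0 by rewrite expf_neq0.
  move: (a ^+ _) (cot_den p q ^+ g) d0 n.+1%:R rl => x y y0 z z0 x0.
  by field; rewrite pq0 x0 y0 gt_eqF.
have X_le : X <= n.+1%:R ^+ 2 * expR (40 * L0 * g.+1%:R ^+ 2).
  have -> : X = n.+1%:R ^+ 2 * (Q * cot_den p q ^+ (g * 2) *
      ((2 ^ j)%:R * 256 ^+ g.+1) ^+ (16 * g + 4)).
    rewrite XE; move: (n.+1%:R ^+ 2) (cot_den p q ^+ _) (_ ^+ (16 * g + 4)) => x y z.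
    by rewrite (mulrC Q) -!mulrA.
  rewrite ler_wpM2l ?sqr_ge0 //.
  by apply: growth_bound; rewrite ?L0_ge0 ?Q0 ?D0 ?ler0n.
have M_le : M%:R <= (2 * n + 2)%:R ^+ 2 * expR (40 * L0 * g.+1%:R ^+ 2).
  have e1 : 1 <= expR (40 * L0 * g.+1%:R ^+ 2).
    by rewrite -[leLHS]expR0 ler_expR !mulr_ge0 // ?sqr_ge0.
  have n1 : 1 <= n.+1%:R ^+ 2 :> R by rewrite exprn_ege1 // ler1n.
  have -> : (2 * n + 2)%:R = 2 * n.+1%:R :> R by rewrite -natrM; congr _%:R; clear; lia.
  move: X_le; move: (expR _) e1 => Z Z1 X_le.
  have : 1 <= n.+1%:R ^+ 2 * Z by rewrite mulr_ege1.
  have -> : (2 * n.+1%:R) ^+ 2 * Z = 4 * (n.+1%:R ^+ 2 * Z) by ring.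
  rewrite /M -(natr1 (Num.truncn X)); move: X_le MX1.
  by move: (n.+1%:R ^+ 2 * Z) => y; lra.
have -> : (n %/ g.+1 + 3 = 2 + (n %/ g.+1).+1)%N by rewrite addnC.
rewrite natrM natrX exprD mulrA [X in _ <= X * _]mulrC.
by apply: ler_wpM2r M_le; rewrite exprn_ge0.
Qed.

(** With y = (ln n) / 3 and g the integer part of e^y, the exponent on the left is at most e^(2y)
    times an affine function of y, while n^mu = e^(2y) e^(kap y). *)
Lemma subexponential (L mu : R) : 0 <= L -> 2 < 3 * mu -> exists N, forall n, (N <= n)%N ->
  exists g, expR (L * g.+1%:R ^+ 2) * (2 * n + 2)%:R ^+ (n %/ g.+1 + 3) <
    expR (n%:R `^ mu).
Proof.
move=> L0 mu0; set kap := 3 * mu - 2.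
have k0 : 0 < kap by rewrite /kap; lra.
(* The affine function is a + 12y = 4L + 4(4 + 3y). The choice of [Y] makes (kap y)^2 / 4 at least
   (12 + a) y, which dominates a + 12y since y >= 1. *)
pose a := 4 * L + 16.
pose Y := 4 * (12 + a) / kap ^+ 2 + 1.
have Y1 : 1 <= Y by rewrite /Y lerDr divr_ge0 ?sqr_ge0 // /a; lra.
exists (Num.truncn (expR (3 * Y))).+1 => n Nn.
have n0 : (0 < n)%N by apply: leq_trans Nn.
pose y := ln n%:R / 3 : R.
have ny : n%:R = expR (3 * y) :> R.
  by rewrite /y mulrC divfK // lnK // posrE ltr0n.
have yY : Y <= y.
  rewrite -(ler_pM2l (_ : 0 < 3)) // -ler_expR -ny.
  apply: le_trans (ltW (_ : _ < (Num.truncn (expR (3 * Y))).+1%:R)) _.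
    by have /andP[] := truncn_itv (expR_ge0 (3 * Y)).
  by rewrite ler_nat.
have y1 : 1 <= y := le_trans Y1 yY.
have h4 : 0 <= kap * y by rewrite mulr_ge0; lra.
have key : a + 12 * y < expR (kap * y).
  apply: (@lt_le_trans _ _ ((1 + kap * y / 2) ^+ 2)); last first.
    have -> : expR (kap * y) = expR (kap * y / 2) ^+ 2.
      by rewrite expr2 -expRD; congr expR; field.
    by apply: lerXn2r; rewrite ?nnegrE ?expR_ge0 ?expR_ge1Dx //; lra.
  have h1 : 4 * (12 + a) <= kap ^+ 2 * y.
    have : 4 * (12 + a) / kap ^+ 2 <= y by move: yY; rewrite /Y; lra.
    by rewrite ler_pdivrMr ?exprn_gt0 // (mulrC y).
  have h2 : 4 * (12 + a) * y <= kap ^+ 2 * y * y by rewrite ler_wpM2r //; lra.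
  have h3 : a <= a * y by rewrite ler_peMr // /a; lra.
  have e : (1 + kap * y / 2) ^+ 2 = 1 + kap * y + kap ^+ 2 * y * y / 4 by field.
  rewrite e; lra.
set g := Num.truncn (expR y); exists g.
have [g1 g2] := andP (truncn_itv (expR_ge0 y)).
rewrite -/g in g1 g2.
have ey1 : 1 <= expR y by rewrite -expR0 ler_expR; lra.
have gs : g.+1%:R <= 2 * expR y by rewrite -natr1; lra.
have g3 : 0 < g.+1%:R :> R by rewrite ltr0n.
have g4 : L * g.+1%:R ^+ 2 <= 4 * L * expR (2 * y).
  have -> : 4 * L * expR (2 * y) = L * (2 * expR y) ^+ 2.
    have -> : 2 * y = y + y by ring.
    by rewrite expRD; ring.
  by rewrite ler_wpM2l // lerXn2r // nnegrE; lra.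
have q1 : (n %/ g.+1)%:R <= expR (2 * y).
  rewrite -(ler_pM2r g3); apply: le_trans (_ : n%:R <= _).
    by rewrite -natrM ler_nat leq_trunc_div.
  have -> : n%:R = expR (2 * y) * expR y by rewrite ny -expRD; congr expR; ring.
  by rewrite ler_wpM2l ?expR_ge0 // ltW.
have e2y : 1 <= expR (2 * y) by rewrite -[leLHS]expR0 ler_expR; lra.
have q2 : (n %/ g.+1 + 3)%:R <= 4 * expR (2 * y) by rewrite natrD; lra.
have b1 : (2 * n + 2)%:R <= expR (4 + 3 * y).
  rewrite expRD -ny; have h : (2 * n + 2)%:R <= 4 * n%:R :> R.
    by rewrite -natrM ler_nat; move: n0; clear; lia.
  apply: le_trans h _; rewrite ler_wpM2r //.
  by apply: le_trans (expR_ge1Dx 4); lra.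
have b2 : (2 * n + 2)%:R ^+ (n %/ g.+1 + 3) <= expR ((4 + 3 * y) * (4 * expR (2 * y))).
  apply: le_trans (_ : expR (4 + 3 * y) ^+ (n %/ g.+1 + 3) <= _).
    by rewrite lerXn2r ?nnegrE ?expR_ge0.
  rewrite -expRM_natl ler_expR mulrC ler_wpM2l //; lra.
have -> : n%:R `^ mu = expR (2 * y) * expR (kap * y).
  rewrite -expRD ny /powR gt_eqF ?expR_gt0 // expRK.
  by congr expR; rewrite /kap; ring.
apply: le_lt_trans (_ : expR (4 * L * expR (2 * y)) *
    expR ((4 + 3 * y) * (4 * expR (2 * y))) < _).
  by rewrite ler_pM ?expR_ge0 ?exprn_ge0 // ler_expR.
rewrite -expRD ltr_expR.
have -> : 4 * L * expR (2 * y) + (4 + 3 * y) * (4 * expR (2 * y)) =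
  expR (2 * y) * (a + 12 * y) by rewrite /a; ring.
by rewrite ltr_pM2l // expR_gt0.
Qed.

End Subexponential.

(** * From words to gaps between good lengths *)

Lemma Pcount_le (R : realType) (a b : R) n v : 0 < a -> 0 < b -> a + b < pi ->
  (Pcount a b n v <= ((size (words (vtx a b) v n))%:R)%:E)%E.
Proof.
move=> a0 b0 ab; apply: ge_ereal_sup => _ [L [uL HL] <-].
rewrite lee_fin ler_nat.
have code s : {c : seq 'I_3 | s \in L ->
    [/\ c \in words (vtx a b) v n, admissible (vtx a b) v c & coded a b v s c]}.
  apply: cid; case: (boolP (s \in L)) => [sL|_]; last by exists [::].
  have [gs ls] := HL s sL.
  have [c [ac sc] cs] := gen_diag_coded a0 b0 ab gs.
  by exists c => _; split=> //; apply/mem_words; rewrite sc.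
pose f s := sval (code s).
have fP s : s \in L -> [/\ f s \in words (vtx a b) v n, admissible (vtx a b) v (f s) &
    coded a b v s (f s)] := svalP (code s).
rewrite -(size_map f); apply: uniq_leq_size.
  rewrite map_inj_in_uniq // => s1 s2 /fP[_ a1 c1] /fP[_ _ c2] e.
  by rewrite -e in c2; apply: (coded_inj a0 b0 ab a1).
by move=> c /mapP[s /fP[cw _ _] ->].
Qed.

Lemma gap_property_of_separated (R : realType) (a b : R) j :
  0 < a -> 0 < b -> a + b < pi -> well_separated j (cotg a) (cotg b) ->
  gap_property a b.
Proof.
move=> a0 b0 ab sep v mu mu3 S.
have mu2 : 2 < 3 * mu.
  (* As 25/9 < 3, the hypothesis gives mu > 2/3, the exponent of the count. *)
  have : 5 / 3 < Num.sqrt 3 :> R.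
    by rewrite -(ltr_pXn2r (ltn0Sn 1)) ?nnegrE ?sqrtr_ge0 ?sqr_sqrtr //; lra.
  lra.
have [pq0 VE] := vtx_cot a0 b0 ab.
have [L L0 HL] := words_count_le v (vtx_area_gt0 a0 b0 ab) pq0 (funext VE) sep.
have [N HN] := subexponential L0 mu2.
have NS n : (N < n)%N -> S n.
  move=> Nn; split; first exact: leq_ltn_trans Nn.
  have [g hg] := HN n (ltnW Nn).
  apply: le_lt_trans (Pcount_le n v a0 b0 ab) _; rewrite lte_fin.
  exact: le_lt_trans (HL n g) hg.
split.
  (* All integers above [N] are in [S], so the image of [S] under subtraction of N + 1 contains
     every natural number. *)
  move=> /(finite_image (subn^~ N.+1)) fS; apply: infinite_nat.
  apply: sub_finite_set fS => n _; exists (n + N.+1)%N; last exact: addnK.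
  by apply: NS; rewrite addnS ltnS leq_addl.
(* The next element is n + 1; starting at N + 2 ensures n > 1, so that the gap 1 is below n^(1 +
   eps). *)
move=> eps eps0; exists (N + 2)%N => n _ Nn; exists n.+1; split; [|split=> //].
  by apply: NS; rewrite ltnS (leq_trans _ Nn) // leq_addr.
rewrite -natr1 addrAC subrr add0r.
have n1 : 1 < n%:R :> R by rewrite ltr1n (leq_trans _ Nn) // addn2.
rewrite /powR gt_eqF ?(lt_trans ltr01) // -[ltLHS]expR0 ltr_expR.
by rewrite mulr_gt0 ?ln_gt0 // addr_gt0.
Qed.

Theorem theorem4p3 (R : realType) :
  ((@lebesgue_measure R) \x (@lebesgue_measure R))%E.-negligible
    [set p : R * R | [/\ 0 < p.1, 0 < p.2, p.1 + p.2 < pi & ~ gap_property p.1 p.2]].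
Proof.
apply: negligibleS (@separated_ae R) => -[a b] /= [a0 b0 ab ngap].
have [pq0 _] := vtx_cot a0 b0 ab; split=> //.
- by rewrite a0 (lt_trans _ ab) // ltrDl.
- by rewrite b0 (lt_trans _ ab) // ltrDr.
by move=> [j sep]; apply: ngap; apply: gap_property_of_separated sep.
Qed.
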